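(* Let $n\ge2$ be an integer, $\alpha>0$ real, and let $X_1,\ldots,X_n$ be independent random variables, each with density $(\Gamma(\alpha))^{-1}e^{-x}x^{\alpha-1}$, $x>0$. Let $H_{\alpha,n}(r)=\Pr\{\sum_{i=1}^nX_i^2\le r^2\}$ for $r>0$. Then for every $\lambda>0$ and every $r>0$, $$H_{\alpha,n}(r)=\sum_{k=0}^\infty\delta_{\alpha,n,k,\lambda}\binom{\alpha n+k-1}{k}G_{\alpha n+k}(\lambda r),\qquad \delta_{\alpha,n,k,\lambda}=\sum_{j=0}^k(-1)^j\binom{k}{j}\lambda^{-(\alpha n+j)}\mu_{\alpha,n,j}.$$ In particular, for $\lambda=\sqrt n$ this is a probability mixture: $\delta_{\alpha,n,k,\sqrt n}=\mathbb E\big((\cos\Phi)^{\alpha n}(1-\cos\Phi)^k\big)>0$ for all $k\ge0$ and $$\sum_{k=0}^\infty\binom{\alpha n+k-1}{k}\delta_{\alpha,n,k,\sqrt n}=1.$$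
   Context: For $\beta>0$, $G_\beta(x)=\frac1{\Gamma(\beta)}\int_0^x\xi^{\beta-1}e^{-\xi}\,d\xi$ is the gamma distribution function of order $\beta$. $\Phi$ is the (random) angle between $(X_1,\ldots,X_n)$ and $(1,\ldots,1)$ in $\mathbb R^n$, i.e. $\sqrt n\cos\Phi=\big(\sum_iX_i\big)\big(\sum_iX_i^2\big)^{-1/2}$, and $\mu_{\alpha,n,k}=\mathbb E\big((\sqrt n\cos\Phi)^{\alpha n+k}\big)$ for integers $k\ge0$. For real $x$ and integer $k\ge0$, $\binom{x}{k}=x(x-1)\cdots(x-k+1)/k!$ (equal to $1$ for $k=0$). *)

(* Defs.v *)
(* MathComp-Analysis. *)
From HB Require Import structures.
From mathcomp Require Import all_boot all_order all_algebra.
From mathcomp Require Import all_classical all_reals all_analysis.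

Set Implicit Arguments.
Unset Strict Implicit.
Unset Printing Implicit Defensive.

Import Order.TTheory GRing.Theory Num.Theory.
Import numFieldNormedType.Exports.

Local Open Scope classical_set_scope.
Local Open Scope ring_scope.

Section GammaLaw.
Variable R : realType.

Definition Gamma (b : R) : R :=
  \int[lebesgue_measure]_(x in `]0, +oo[) (x `^ (b - 1) * expR (- x)).

Definition gamma_cdf (b x : R) : R :=
  (Gamma b)^-1 *
  \int[lebesgue_measure]_(t in `]0, x]) (t `^ (b - 1) * expR (- t)).

Definition gamma_density (a x : R) : R :=
  if 0 < x then (Gamma a)^-1 * expR (- x) * x `^ (a - 1) else 0.

Definition gbinom (x : R) (k : nat) : R :=
  (\prod_(i < k) (x - i%:R)) / k`!%:R.

Definition dotp (n : nat) (x y : 'I_n -> R) : R := \sum_(i < n) x i * y i.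

(* [x / 0] is [0] here, so the angle is [pi / 2] when [x] or [y] is zero. *)
Definition angle (n : nat) (x y : 'I_n -> R) : R :=
  acos (dotp x y / (Num.sqrt (dotp x x) * Num.sqrt (dotp y y))).

End GammaLaw.

Section RandomSample.
Context {d : measure_display} {T : measurableType d} {R : realType}.
Variable P : probability T R.

Definition has_density (X : {RV P >-> R}) (f : R -> R) : Prop :=
  forall A : set R, measurable A ->
    distribution P X A = (\int[lebesgue_measure]_(x in A) (f x)%:E)%E.

Definition mutually_independent (n : nat) (X : 'I_n -> {RV P >-> R}) : Prop :=
  forall (J : {set 'I_n}) (A : 'I_n -> set R),
    (forall i, measurable (A i)) ->
    P (\bigcap_(i in [set i | i \in J]) (X i @^-1` A i)) =
    (\prod_(i in J) P (X i @^-1` A i))%E.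

Variables (n : nat) (X : 'I_n -> {RV P >-> R}).

Definition Phi (w : T) : R := angle (fun i => X i w) (fun=> 1).

(* The random variable under the expectation takes values in a compact
   interval almost surely for gamma variables, so [fine] loses nothing. *)
Definition mu_moment (alpha : R) (k : nat) : R :=
  fine ('E_P[fun w => ((Num.sqrt n%:R * cos (Phi w))
                         `^ (alpha * n%:R + k%:R))%R])%E.

Definition delta (alpha : R) (k : nat) (lambda : R) : R :=
  \sum_(j < k.+1) (-1) ^+ j * 'C(k, j)%:R
    * lambda `^ (- (alpha * n%:R + j%:R)) * mu_moment alpha j.

Definition H_radial (r : R) : R :=
  fine (P [set w | \sum_(i < n) X i w ^+ 2 <= r ^+ 2]).

End RandomSample.

(* Main.v *)
Require Import Defs.
From HB Require Import structures.
From mathcomp Require Import all_boot all_order all_algebra.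
From mathcomp Require Import all_classical all_reals all_analysis.
From mathcomp Require Import measurable_realfun ring.

Set Implicit Arguments.
Unset Strict Implicit.
Unset Printing Implicit Defensive.

Import Order.TTheory GRing.Theory Num.Theory.
Import numFieldNormedType.Exports.

Local Open Scope classical_set_scope.
Local Open Scope ring_scope.

(** Let [S] be the sum and [Q] the sum of squares of the sample, [a = alpha * n],
    and [U = S / sqrt Q = sqrt n * cos Phi], so that the norm of the sample is
    [S / U]. A gamma sample has the classical property that [S] follows the gamma
    law of order [a] and is independent of the direction of the sample, hence of
    [U]. Therefore [H r = P (S <= r * U)] is the expectation of [G_a (r * U)]
    ([radial_law], [radial_mixture]).

    The expansion then holds pointwise in [v = U / lambda]: up to the factor
    [v ^ a / Gamma a], the [k]-th term of
    [\sum_k v ^ a * (1 - v) ^ k * binom (a + k - 1) k * G_(a + k) x]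
    is the integral over [0 < t <= x] of the [k]-th term of the exponential series
    of [t ^ (a - 1) * exp (- t) * exp ((1 - v) * t)], because
    [binom (a + k - 1) k = Gamma (a + k) / (k! * Gamma a)]. The sum is thus
    [v ^ a / Gamma a] times the integral of [t ^ (a - 1) * exp (- v * t)], that is,
    [G_a (v * x)] ([gamma_cdf_mixture]). Since [0 < U <= sqrt n] almost surely, all
    partial sums are bounded by a constant and dominated convergence exchanges the
    series with the expectation. By the binomial theorem the expectation of
    [v ^ a * (1 - v) ^ k] is the coefficient [delta] ([deltaE]). For
    [lambda = sqrt n], [v = cos Phi] lies in [0, 1], the same computation on the
    whole half-line is the negative binomial series, which sums the weights to 1
    ([negative_binomial_series]), and [delta] is positive because equality in the
    Cauchy-Schwarz inequality, which forces all observations to be equal, has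
    probability less than 1 ([delta_pos]).

    The independence of [S] and the direction is obtained from dilations, in place
    of a change of variables in dimension [n]. Dilating one gamma variable by [c]
    amounts to weighting its law by an exponential ([gamma_rv_scale]); by
    independence and induction on the sample, so does dilating the pair [(S, Q)]
    ([gamma_sum_scale]). Averaging this identity over all dilations [c] with a
    suitable density yields integration in polar coordinates for the law of
    [(S, Q)] ([integral_polar]): the expectation of [F (S, Q)] is a weighted
    expectation of the integral of [F] along the ray through [(S, Q)] against the
    gamma kernel of order [a]. Applying this to the indicator of [Q <= r ^ 2], and
    then to the ray integral that results, which is constant along rays, eliminates
    the weight. *)

(** * Dilations of Lebesgue measure *)

Section scaling.
Context {R : realType}.
Local Notation mu := (@lebesgue_measure R).
Local Open Scope ereal_scope.

Lemma lebesgue_measure_scale (c : R) (A : set R) : (0 < c)%R -> measurable A ->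
  mu A = c%:E * mu ( *%R c @^-1` A).
Proof.
move=> c0 mA.
have mc : measurable_fun setT ( *%R c : R -> R) by exact: mulrl_measurable.
have cp : (0 <= c)%R by exact: ltW.
pose phi : measurableTypeR R -> measurableTypeR R := *%R c.
have mphi : measurable_fun setT phi by exact: mc.
pose m1 : {measure set (measurableTypeR R) -> \bar R} :=
  measure_function_pushforward__canonical__measure_function_Measure mu mphi.
pose m := mscale (NngNum cp) m1.
apply: (@lebesgue_measure_unique R m) => // _ [[a b] _ <-].
rewrite /m /= /mscale /= /pushforward.
have -> : *%R c @^-1` `]a, b]%classic = `](a / c)%R, (b / c)%R]%classic.
  apply/seteqP; split => x /=; rewrite !in_itv/=;
  by rewrite ltr_pdivrMr// ler_pdivlMr// ![(_ * c)%R]mulrC.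
rewrite !lebesgue_measure_itv/= !lte_fin ltr_pM2r ?invr_gt0//.
case: ifP => _; last by rewrite mule0.
rewrite -!EFinB -EFinM; congr EFin.
by rewrite -mulrBl mulrC divfK// gt_eqF.
Qed.


Lemma ge0_integral_scale (c : R) (D : set R) (h : R -> \bar R) :
  (0 < c)%R -> measurable D -> measurable_fun D h ->
  (forall x, D x -> 0 <= h x) ->
  \int[mu]_(x in D) h x = c%:E * \int[mu]_(x in *%R c @^-1` D) h (c * x)%R.
Proof.
move=> c0 mD mh h0.
pose phi : measurableTypeR R -> measurableTypeR R := *%R c.
have mphi : measurable_fun setT phi by exact: mulrl_measurable.
pose m1 : {measure set (measurableTypeR R) -> \bar R} :=
  measure_function_pushforward__canonical__measure_function_Measure mu mphi.
have cp : (0 <= c)%R by exact: ltW.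
transitivity (\int[mscale (NngNum cp) m1]_(x in D) h x).
  by apply: eq_measure_integral => A mA _ /=; exact: (lebesgue_measure_scale c0 mA).
rewrite ge0_integral_mscale//=; congr (_ * _).
by rewrite ge0_integral_pushforward// => x; rewrite inE; exact: h0.
Qed.

Lemma preimage_scale_pos (c : R) : (0 < c)%R ->
  *%R c @^-1` `]0%R, +oo[%classic = `]0%R, +oo[%classic :> set R.
Proof.
by move=> c0; apply/seteqP; split => x /=; rewrite !in_itv/= !andbT pmulr_rgt0.
Qed.

Lemma ge0_integral_scale_pos (c : R) (h : R -> \bar R) : (0 < c)%R ->
  measurable_fun (`]0%R, +oo[ : set R) h -> (forall x, (0 < x)%R -> 0 <= h x) ->
  \int[mu]_(x in `]0%R, +oo[) h x =
  c%:E * \int[mu]_(x in `]0%R, +oo[) h (c * x)%R.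
Proof.
move=> c0 mh h0; rewrite (ge0_integral_scale c0)// ?preimage_scale_pos//.
by move=> x /=; rewrite in_itv/= andbT; exact: h0.
Qed.

End scaling.

(** * Tonelli on subdomains *)

(** Driven by the syntax of the function, as unification with the composition
    lemmas up to conversion does not end in reasonable time. *)
Ltac mfun :=
  lazymatch goal with
  | |- measurable_fun _ fst => exact: measurable_fst
  | |- measurable_fun _ snd => exact: measurable_snd
  | |- measurable_fun _ (fun x => EFin (@?f x)) =>
      refine (proj2 (measurable_EFinP _ f) _); cbv beta; mfun
  | |- measurable_fun _ (fun x => (@?f x + @?g x)%R) =>
      refine (@measurable_funD _ _ _ _ f g _ _); cbv beta; mfun
  | |- measurable_fun _ (fun x => (@?f x * @?g x)%R) =>
      refine (@measurable_funM _ _ _ _ f g _ _); cbv beta; mfun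
  | |- measurable_fun _ (fun x => (- @?f x)%R) =>
      refine (@measurable_funN _ _ _ _ f _); cbv beta; mfun
  | |- measurable_fun _ (fun x => (@?f x ^+ ?n)%R) =>
      refine (@measurable_funX _ _ _ _ f n _); cbv beta; mfun
  | |- measurable_fun _ (fun x => expR (@?f x)) =>
      refine (measurableT_comp (@measurable_expR _) (g := f) _); cbv beta; mfun
  | |- measurable_fun _ (fun x => powR (@?f x) ?p) =>
      refine (measurableT_comp (measurable_powR p) (g := f) _); cbv beta; mfun
  | |- _ => first [ assumption | exact: measurable_id | exact: measurable_cst
                  | exact: measurable_fst | exact: measurable_snd | idtac ]
  end.

Section tonelli.
Context {R : realType} {d1 d2 : measure_display}.
Context {T1 : measurableType d1} {T2 : measurableType d2}.
Variables (m1 : {sigma_finite_measure set T1 -> \bar R}).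
Variables (m2 : {sigma_finite_measure set T2 -> \bar R}).
Local Open Scope ereal_scope.

Lemma tonelli_on (D1 : set T1) (D2 : set T2) (f : T1 * T2 -> \bar R) :
  measurable D1 -> measurable D2 -> measurable_fun setT f ->
  (forall p, 0 <= f p) ->
  \int[m1]_(x in D1) \int[m2]_(y in D2) f (x, y) =
  \int[m2]_(y in D2) \int[m1]_(x in D1) f (x, y).
Proof.
move=> mD1 mD2 mf f0.
pose g := f \_ (D1 `*` D2).
have mg : measurable_fun setT g.
  by apply/(measurable_restrictT f) => //; [exact: measurableX|exact: measurable_funTS].
have g0 p : 0 <= g p by rewrite /g patchE; case: ifP.
have gE x y : g (x, y) = if (x \in D1) && (y \in D2) then f (x, y) else 0.
  by rewrite /g patchE in_setX.
rewrite integral_mkcond [RHS]integral_mkcond.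
transitivity (\int[m1]_x \int[m2]_y g (x, y)).
  apply: eq_integral => x _; rewrite patchE; case: ifPn => xD.
    rewrite [LHS]integral_mkcond; apply: (@eq_integral _ _ _ m2) => y _.
    by rewrite gE xD patchE.
  by rewrite integral0_eq// => y _; rewrite gE (negbTE xD).
rewrite fubini_tonelli//.
apply: eq_integral => y _; rewrite patchE; case: ifPn => yD.
  rewrite [RHS]integral_mkcond; apply: (@eq_integral _ _ _ m1) => x _.
  by rewrite gE yD andbT patchE.
by rewrite integral0_eq// => x _; rewrite gE (negbTE yD) andbF.
Qed.

Lemma measurable_integral_on (D2 : set T2) (f : T1 * T2 -> \bar R) :
  measurable D2 -> measurable_fun setT f -> (forall p, 0 <= f p) ->
  measurable_fun setT (fun x => \int[m2]_(y in D2) f (x, y)).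
Proof.
move=> mD2 mf f0; pose g := f \_ (setT `*` D2).
have mg : measurable_fun setT g.
  by apply/(measurable_restrictT f) => //; [exact: measurableX|exact: measurable_funTS].
have g0 p : 0 <= g p by rewrite /g patchE; case: ifP.
rewrite (_ : (fun x => _) = fubini_F m2 g).
  exact: measurable_fun_fubini_tonelli_F.
apply/funext => x; rewrite /fubini_F [LHS]integral_mkcond.
apply: (@eq_integral _ _ _ m2) => y _.
by rewrite /g !patchE in_setX in_setT.
Qed.

End tonelli.

(** * The gamma integral *)

Section gamma_integral.
Context {R : realType}.
Local Notation mu := (@lebesgue_measure R).

Definition gamma_kernel (a x : R) : R := x `^ (a - 1) * expR (- x).

Lemma gamma_kernel_ge0 a x : 0 <= gamma_kernel a x.
Proof. by rewrite mulr_ge0 ?powR_ge0 ?expR_ge0. Qed.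

Lemma measurable_gamma_kernel a : measurable_fun setT (gamma_kernel a).
Proof.
apply: measurable_funM; first exact: measurable_powR.
by apply: measurableT_comp => //; exact: measurable_expR.
Qed.

Lemma powR_ge1 (a x : R) : 0 <= a -> 1 <= x -> 1 <= x `^ a.
Proof. by move=> a0 x1; rewrite -(powRr0 x) ler_powR. Qed.

Lemma powR_le1 (a x : R) : 0 <= a -> 0 <= x <= 1 -> x `^ a <= 1.
Proof.
move=> a0 /andP[x0 x1].
by have := ge0_ler_powR a0 x0 ler01 x1; rewrite powR1.
Qed.

Lemma mulr_powR (x b : R) : 0 < x -> x * x `^ b = x `^ (b + 1).
Proof.
move=> x0; rewrite powRD; last by rewrite (gt_eqF x0) implybT.
by rewrite powRr1 1?mulrC// ltW.
Qed.

Lemma gamma_kernelS a x : 0 <= x -> 0 < a ->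
  gamma_kernel (a + 1) x = x * gamma_kernel a x.
Proof.
move=> x0 a0.
by rewrite /gamma_kernel addrK mulrA mulr_powRB1.
Qed.

(** The kernel is homogeneous up to the change of rate of the exponential; every
    dilation argument below rests on this identity. *)
Lemma gamma_kernel_scale a c x : 0 < c -> 0 < x ->
  x `^ (a - 1) * expR (- (x * c)) = c `^ (- a) * (c * gamma_kernel a (c * x)).
Proof.
move=> c0 x0; rewrite /gamma_kernel powRM ?ltW//.
have -> : c `^ (- a) = (c * c `^ (a - 1))^-1.
  by rewrite mulr_powR// subrK powRN.
by rewrite [c * x]mulrC; field; rewrite !gt_eqF// powR_gt0.
Qed.

Lemma measurable_EFin_gamma_kernel a (D : set R) :
  measurable_fun D (fun x => (gamma_kernel a x)%:E).
Proof.
by apply: measurable_funTS; apply/measurable_EFinP; exact: measurable_gamma_kernel.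
Qed.

Local Open Scope ereal_scope.

Lemma integral_expRN (x s : R) : (0 < x)%R ->
  \int[mu]_(c in `[s, +oo[) (expR (- (x * c)))%:E = (x^-1 * expR (- (x * s)))%:E.
Proof.
move=> x0.
have ce : continuous (fun c : R => expR (- (x * c))).
  move=> c; apply: continuous_comp; last exact: continuous_expR.
  by apply: (@continuousN _ R^o); apply: mulrl_continuous.
rewrite (@ge0_continuous_FTC2y _ _ (fun c => - x^-1 * expR (- (x * c)))%R _ 0%R).
- by rewrite -EFinB sub0r mulNr opprK.
- by move=> c _; exact: expR_ge0.
- exact: continuous_subspaceT.
- rewrite -(mulr0 (- x^-1)%R); apply: cvgMr.
  apply: (@cvg_comp _ _ _ _ (fun y => expR (- y))%R); last exact: cvgr_expR.
  exact: gt0_cvgMry.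
- by move=> c _; exact: ex_derive.
- by apply/cvg_at_right_filter; apply: cvgMr; exact: ce.
- move=> c _; rewrite derive1Ml; last exact: ex_derive.
  rewrite derive1_comp// derive1E derive_val derive1N// derive1Ml// derive1_id.
  by field; rewrite gt_eqF.
Qed.

Lemma powRN_cvgy0 (a : R) : (0 < a)%R -> (x `^ (- a))%R @[x --> +oo%R] --> 0%R.
Proof.
move=> a0; apply/cvgr0Pnorm_le => e e0 /=; near=> x.
have x0 : (0 < x)%R by near: x; exact: nbhs_pinfty_gt.
rewrite ger0_norm ?powR_ge0// powRN invf_ple ?posrE ?powR_gt0//.
have -> : (e^-1 = (e^-1 `^ a^-1) `^ a)%R.
  by rewrite -powRrM mulVf ?gt_eqF// powRr1// invr_ge0 ltW.
apply: ge0_ler_powR; rewrite ?nnegrE ?powR_ge0// ltW//.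
Unshelve. all: by end_near. Qed.

(** The substitute for integration by parts in [gammaE_rec]: it turns a division
    by [a] into an average over rates. *)
Lemma integral_powRNS (a : R) : (0 < a)%R ->
  \int[mu]_(c in `[1%R, +oo[) (c `^ (- a - 1))%:E = (a^-1)%:E.
Proof.
move=> a0.
have pos (c : R) : (1 <= c)%R -> c \in `]0%R, +oo[.
  by move=> c1; rewrite in_itv/= andbT (lt_le_trans _ c1).
have dp (b c : R) : (1 <= c)%R -> derivable (@powR R ^~ b) c 1.
  by move=> c1; apply: derivable_powR; exact: pos.
have cp (b c : R) : (1 <= c)%R -> {for c, continuous (@powR R ^~ b)}.
  by move=> c1; apply/differentiable_continuous/derivable1_diffP; exact: dp.
rewrite (@ge0_continuous_FTC2y _ _ (fun c => - a^-1 * c `^ (- a))%R _ 0%R).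
- by rewrite -EFinB sub0r mulNr opprK powR1 mulr1.
- by move=> c _; exact: powR_ge0.
- apply: derivable_within_continuous => c; rewrite in_itv/= andbT.
  exact: dp.
- rewrite -(mulr0 (- a^-1)%R); apply: cvgMr; exact: powRN_cvgy0.
- by move=> c c1; apply: derivableM => //; exact: dp (ltW c1).
- by apply/cvg_at_right_filter; apply: cvgMr; exact: cp.
- move=> c; rewrite in_itv/= andbT => c1.
  rewrite derive1Ml; last exact: dp (ltW c1).
  rewrite powR_derive1; last exact: pos (ltW c1).
  by field; rewrite gt_eqF.
Qed.

(** The Gamma integral in the extended reals, where Tonelli applies before
    finiteness is known. *)
Definition gammaE (a : R) : \bar R :=
  \int[mu]_(x in `]0%R, +oo[) (gamma_kernel a x)%:E.

Lemma gammaE_ge0 a : 0 <= gammaE a.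
Proof. by apply: integral_ge0 => x _; rewrite lee_fin gamma_kernel_ge0. Qed.

Lemma gammaE_scale (a c : R) : (0 < c)%R ->
  \int[mu]_(x in `]0%R, +oo[) (x `^ (a - 1) * expR (- (x * c)))%:E =
  (c `^ (- a))%:E * gammaE a.
Proof.
move=> c0; rewrite /gammaE (@ge0_integral_scale_pos _ c (EFin \o gamma_kernel a))//.
- rewrite -ge0_integralZl_EFin//=.
  + rewrite -ge0_integralZl_EFin//=.
    * apply: eq_integral => x; rewrite inE/= in_itv/= andbT => x0.
      by rewrite -!EFinM; congr EFin; exact: gamma_kernel_scale.
    * by move=> x _; rewrite mule_ge0// lee_fin ?gamma_kernel_ge0// ltW.
    * apply: measurable_funTS; apply: emeasurable_funM; first exact: measurable_cst.
      apply/measurable_EFinP; apply: (measurableT_comp (measurable_gamma_kernel a)).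
      exact: mulrl_measurable.
    * exact: powR_ge0.
  + by move=> x _; rewrite lee_fin gamma_kernel_ge0.
  + apply: measurable_funTS; apply/measurable_EFinP.
    apply: (measurableT_comp (measurable_gamma_kernel a)).
    exact: mulrl_measurable.
  + exact: ltW.
- exact: measurable_EFin_gamma_kernel.
- by move=> x x0; rewrite lee_fin gamma_kernel_ge0.
Qed.

(** By [gammaE_scale], integrating [c ^ (- a - 1) * Gamma (a + 1)] over the rates
    [c >= 1] gives the double integral of [x ^ a * exp (- c * x)]. Its other
    iterated integral is [Gamma a], since the integral of [exp (- c * x)] over
    [c >= 1] is [exp (- x) / x]. *)
Lemma gammaE_rec (a : R) : (0 < a)%R -> gammaE (a + 1) = a%:E * gammaE a.
Proof.
move=> a0.
suff H : (a^-1)%:E * gammaE (a + 1) = gammaE a.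
  by rewrite -H muleA -EFinM divff ?mul1e// gt_eqF.
rewrite -integral_powRNS// -ge0_integralZr//; last 3 first.
- by apply: measurable_funTS; mfun.
- by move=> c _; rewrite lee_fin powR_ge0.
- exact: gammaE_ge0.
transitivity (\int[mu]_(c in `[1%R, +oo[) \int[mu]_(x in `]0%R, +oo[)
    (x `^ a * expR (- (x * c)))%:E).
  apply: eq_integral => c; rewrite inE/= in_itv/= andbT => c1.
  have c0 : (0 < c)%R by exact: lt_le_trans c1.
  rewrite -opprD; apply: etrans; first by symmetry; exact: gammaE_scale.
  by under eq_integral do rewrite addrK.
rewrite (@tonelli_on _ _ _ _ _ mu mu _ _
  (fun p => (p.2 `^ a * expR (- (p.2 * p.1)))%:E))//.
- apply: eq_integral => x; rewrite inE/= in_itv/= andbT => x0.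
  under eq_integral do rewrite EFinM.
  rewrite ge0_integralZl_EFin//.
  + rewrite integral_expRN// -EFinM mulr1 /gamma_kernel -(mulr_powRB1 (ltW x0) a0).
    by apply: (congr1 (@EFin R)); field; rewrite gt_eqF.
  + by apply: measurable_funTS; mfun.
  + exact: powR_ge0.
- by mfun.
- by move=> p; rewrite lee_fin mulr_ge0 ?powR_ge0 ?expR_ge0.
Qed.

Lemma gammaE1 : gammaE 1 = 1.
Proof.
rewrite /gammaE.
transitivity (\int[mu]_(x in `]0%R, +oo[) (expR (- (1 * x)))%:E).
  by apply: eq_integral => x _; rewrite /gamma_kernel subrr powRr0 !mul1r.
rewrite integral_itv_obnd_cbnd; last by apply: measurable_funTS; mfun.
by rewrite integral_expRN// mulr0 oppr0 expR0 invr1 mulr1.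
Qed.

(** On this range [x ^ a] lies between the indicator of [x >= 1] and [1 + x]. *)
Lemma gammaE_bounds (a : R) : (0 < a <= 1)%R ->
  0 < gammaE (a + 1) < +oo.
Proof.
move=> /andP[a0 a1]; apply/andP; split.
  apply: (@lt_le_trans _ _ (expR (- 1))%:E); first by rewrite lte_fin expR_gt0.
  have <- : \int[mu]_(x in `[1%R, +oo[) (expR (- (1 * x)))%:E = (expR (- 1))%:E.
    by rewrite integral_expRN// invr1 !mul1r.
  apply: (@le_trans _ _ (\int[mu]_(x in `[1%R, +oo[) (gamma_kernel (a + 1) x)%:E)).
    apply: ge0_le_integral => //.
    - by apply: measurable_funTS; mfun.
    - exact: measurable_EFin_gamma_kernel.
    - move=> x; rewrite /= in_itv/= andbT => x1.
      rewrite lee_fin /gamma_kernel addrK mul1r ler_peMl ?expR_ge0//.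
      by apply: powR_ge1 => //; exact: ltW.
  apply: ge0_subset_integral => //.
  - exact: measurable_EFin_gamma_kernel.
  - by move=> x _; rewrite lee_fin gamma_kernel_ge0.
  - by apply: subset_itvr; rewrite bnd_simp.
apply: (@le_lt_trans _ _ (gammaE 1 + gammaE (1 + 1))); last first.
  by rewrite gammaE_rec// gammaE1 mul1e -EFinD ltry.
rewrite /gammaE -ge0_integralD//=; last 4 first.
- by move=> x _; rewrite lee_fin gamma_kernel_ge0.
- exact: measurable_EFin_gamma_kernel.
- by move=> x _; rewrite lee_fin gamma_kernel_ge0.
- exact: measurable_EFin_gamma_kernel.
apply: ge0_le_integral => //.
- by move=> x _; rewrite lee_fin gamma_kernel_ge0.
- exact: measurable_EFin_gamma_kernel.
- by apply: emeasurable_funD; exact: measurable_EFin_gamma_kernel.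
- move=> x; rewrite /= in_itv/= andbT => x0.
  rewrite -EFinD lee_fin /gamma_kernel !addrK subrr -mulrDl ler_wpM2r ?expR_ge0//.
  rewrite powRr0 powRr1 ?(ltW x0)//.
  have [x1|/ltW x1] := leP x 1%R.
    rewrite ler_wpDr ?(ltW x0)//.
    by apply: powR_le1; rewrite ?x1 ?ltW.
  by rewrite ler_wpDl//; exact: ler1_powR.
Qed.

(** The recurrence reduces every order to the range of [gammaE_bounds]. *)
Lemma gammaE_fin_pos (a : R) : (0 < a)%R -> 0 < gammaE a < +oo.
Proof.
move=> a0.
have [k ak] : exists k : nat, (a <= k.+1%:R)%R.
  exists (Num.bound a); rewrite ltW// (lt_trans (archi_boundP (ltW a0)))//.
  by rewrite ltr_nat.
elim: k a a0 ak => [a a0 a1|k IH a a0 ak].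
  have aE : gammaE a = a^-1%:E * gammaE (a + 1).
    by rewrite gammaE_rec// muleA -EFinM mulVf ?mul1e// gt_eqF.
  have /andP[h1 h2] : 0 < gammaE (a + 1) < +oo by apply: gammaE_bounds; apply/andP.
  rewrite aE mule_gt0 ?lte_fin ?invr_gt0//=.
  by rewrite lte_mul_pinfty// lee_fin invr_ge0 ltW.
have [a1|a1] := leP a k.+1%:R; first exact: IH.
have b0 : (0 < a - 1)%R by rewrite subr_gt0 (le_lt_trans _ a1)// ler1n.
have /andP[h1 h2] : 0 < gammaE (a - 1) < +oo by apply: IH; rewrite ?lerBlDr ?natr1.
rewrite -[a](subrK 1%R) gammaE_rec// mule_gt0//=.
by rewrite lte_mul_pinfty// lee_fin ltW.
Qed.

Lemma Gamma_gt0 (a : R) : (0 < a)%R -> (0 < Gamma a)%R.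
Proof. by move=> /gammaE_fin_pos; exact: fine_gt0. Qed.

Lemma GammaE (a : R) : (0 < a)%R -> gammaE a = (Gamma a)%:E.
Proof.
move=> /gammaE_fin_pos/andP[h1 h2]; rewrite /Gamma /Rintegral fineK//.
by rewrite ge0_fin_numE// gammaE_ge0.
Qed.

Lemma Gamma_rec (a : R) : (0 < a)%R -> Gamma (a + 1) = (a * Gamma a)%R.
Proof.
by move=> a0; apply: EFin_inj; rewrite EFinM -!GammaE ?gammaE_rec// addr_gt0.
Qed.

Lemma integrable_gamma_kernel (a : R) : (0 < a)%R ->
  mu.-integrable (`]0%R, +oo[ : set R) (EFin \o gamma_kernel a).
Proof.
move=> a0; apply/integrableP; split.
  exact: measurable_EFin_gamma_kernel.
under eq_integral do rewrite /= ger0_norm ?gamma_kernel_ge0//.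
by have /andP[] := gammaE_fin_pos a0.
Qed.

Local Close Scope ereal_scope.

(** The generalised binomial coefficient is a quotient of Gamma values, which is
    what turns the mixture of gamma laws into an exponential series. *)
Lemma gbinom_Gamma (a : R) (k : nat) : 0 < a ->
  gbinom (a + k%:R - 1) k = Gamma (a + k%:R) / (k`!%:R * Gamma a).
Proof.
move=> a0; have Ga : Gamma a != 0 by rewrite gt_eqF ?Gamma_gt0.
have -> : Gamma (a + k%:R) = (\prod_(i < k) (a + k%:R - 1 - i%:R)) * Gamma a.
  elim: k => [|k IH]; first by rewrite big_ord0 addr0 mul1r.
  rewrite -natr1 addrA Gamma_rec; last by rewrite ltr_wpDr.
  rewrite IH big_ord_recl/= subr0 addrK mulrA; congr (_ * _ * _).
  by apply: eq_bigr => i _; rewrite /bump/= add1n -natr1; ring.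
by rewrite /gbinom; field; rewrite Ga pnatr_eq0 -lt0n fact_gt0.
Qed.

End gamma_integral.
(** * Series of integrals *)

Section series_integral.
Context {R : realType} {d : measure_display} {T : measurableType d}.
Variables (mu : {measure set T -> \bar R}) (D : set T) (mD : measurable D).

Lemma integrableZl_EFin (c : R) (f : T -> R) : mu.-integrable D (EFin \o f) ->
  mu.-integrable D (EFin \o (fun x => c * f x)).
Proof.
move=> intf; rewrite (_ : EFin \o _ = (fun x => c%:E * (EFin \o f) x)%E)//.
exact: integrableZl.
Qed.

Lemma integrable_series (f_ : nat -> T -> R) (n : nat) :
  (forall k, mu.-integrable D (EFin \o f_ k)) ->
  mu.-integrable D (EFin \o (fun x => series (f_ ^~ x) n)).
Proof.
move=> intf; rewrite (_ : EFin \o _ =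
    fun x => (\sum_(0 <= k < n) (EFin \o f_ k) x)%E); last first.
  by apply/funext => x /=; rewrite sumEFin.
by apply: integrable_sum => // k _; exact: intf.
Qed.

Lemma Rintegral_series (f_ : nat -> T -> R) (n : nat) :
  (forall k, mu.-integrable D (EFin \o f_ k)) ->
  \int[mu]_(x in D) series (f_ ^~ x) n =
  series (fun k => \int[mu]_(x in D) f_ k x) n.
Proof.
move=> intf; elim: n => [|n IH].
  rewrite /series/= big_nil.
  under eq_Rintegral do rewrite big_nil.
  by rewrite /Rintegral integral0.
rewrite {2}/series/= big_nat_recr//= -[X in _ = X + _]IH.
under eq_Rintegral do rewrite /series/= big_nat_recr//=.
by rewrite RintegralD//; exact: integrable_series.
Qed.

(** Dominated convergence for the partial sums; used for the integrals over [t]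
    as well as for the expectations. *)
Lemma series_Rintegral_cvg (f_ : nat -> T -> R) (f g : T -> R) :
  (forall k, mu.-integrable D (EFin \o f_ k)) ->
  measurable_fun D f ->
  {ae mu, forall x, D x -> series (f_ ^~ x) @ \oo --> f x} ->
  mu.-integrable D (EFin \o g) ->
  {ae mu, forall x, D x -> forall n, `|series (f_ ^~ x) n| <= g x} ->
  series (fun k => \int[mu]_(x in D) f_ k x) @ \oo --> \int[mu]_(x in D) f x.
Proof.
move=> intf mf cvf intg leg.
pose F n x : \bar R := (series (f_ ^~ x) n)%:E.
have mF n : measurable_fun D (F n).
  exact: measurable_int (integrable_series n intf).
have mf' : measurable_fun D (EFin \o f) by exact/measurable_EFinP.
have cvF : {ae mu, forall x, D x -> F ^~ x @ \oo --> (EFin \o f) x}.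
  apply: filterS cvf => x cv Dx; apply: cvg_EFin; last exact: cv.
  by near=> n.
have leF : {ae mu, forall x n, D x -> (`|F n x| <= (EFin \o g) x)%E}.
  by apply: filterS leg => x le n Dx; rewrite /= lee_fin; exact: le.
have [intf' _ cvI] := dominated_convergence mD mF mf' cvF intg leF.
rewrite (_ : series _ = fun n => \int[mu]_(x in D) series (f_ ^~ x) n); last first.
  by apply/funext => n; rewrite Rintegral_series.
apply: fine_cvg; rewrite fineK//; exact: integrable_fin_num.
Unshelve. all: by end_near. Qed.

End series_integral.

Section exponential_series.
Context {R : realType}.
Local Notation mu := (@lebesgue_measure R).

Lemma series_exp_coeff_cvg (x : R) : series (exp_coeff x) @ \oo --> expR x.
Proof. exact: is_cvg_series_exp_coeff. Qed.

Lemma normr_series_exp_coeff (x : R) (n : nat) :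
  `|series (exp_coeff x) n| <= expR `|x|.
Proof.
have h k : 0 <= exp_coeff `|x| k by exact: exp_coeff_ge0.
apply: (@le_trans _ _ (series (exp_coeff `|x|) n)).
  apply: le_trans (ler_norm_sum _ _ _) _; apply: ler_sum => k _.
  by rewrite /exp_coeff/= normrM normrX normfV normr_nat.
apply: nondecreasing_cvgn_le; last exact: is_cvg_series_exp_coeff.
by apply: nondecreasing_series.
Qed.

Lemma gamma_kernelDn (a x : R) (k : nat) : 0 < a -> 0 < x ->
  gamma_kernel (a + k%:R) x = x ^+ k * gamma_kernel a x.
Proof.
move=> a0 x0; elim: k => [|k IH]; first by rewrite addr0 expr0 mul1r.
rewrite -natr1 addrA gamma_kernelS ?ltW// ?IH ?exprS ?mulrA//.
by rewrite ltr_wpDr.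
Qed.

(** The exponential series of [exp (y * x)], integrated term by term. The partial
    sums are dominated because those of [exp (y * x)] are bounded by
    [exp (`|y| * x)]. *)
Lemma gamma_kernel_series (a y : R) (D : set R) : 0 < a -> measurable D ->
  D `<=` `]0, +oo[ ->
  mu.-integrable D (EFin \o (fun x => gamma_kernel a x * expR (`|y| * x))) ->
  series (fun k => y ^+ k / k`!%:R *
    \int[mu]_(x in D) gamma_kernel (a + k%:R) x) @ \oo -->
  \int[mu]_(x in D) (gamma_kernel a x * expR (y * x)).
Proof.
move=> a0 mD Dpos intg.
have intk k : mu.-integrable D (EFin \o gamma_kernel (a + k%:R)).
  have ak : 0 < a + k%:R by rewrite ltr_wpDr.
  by apply: integrableS (integrable_gamma_kernel ak).
rewrite (_ : (fun k => _) = fun k =>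
    \int[mu]_(x in D) (y ^+ k / k`!%:R * gamma_kernel (a + k%:R) x)); last first.
  by apply/funext => k; rewrite RintegralZl.
have seriesE x n : D x ->
    series (fun k => y ^+ k / k`!%:R * gamma_kernel (a + k%:R) x) n =
    gamma_kernel a x * series (exp_coeff (y * x)) n.
  move=> /Dpos; rewrite /= in_itv/= andbT => x0.
  rewrite /series/= big_distrr/=; apply: eq_bigr => k _.
  by rewrite gamma_kernelDn// /exp_coeff/= exprMn; ring.
apply: (series_Rintegral_cvg (mu := mu) mD
  (f_ := fun k x => y ^+ k / k`!%:R * gamma_kernel (a + k%:R) x)
  (f := fun x => gamma_kernel a x * expR (y * x))
  (g := fun x => gamma_kernel a x * expR (`|y| * x))) => //.
- by move=> k; exact: integrableZl_EFin.
- by apply: measurable_funTS; apply: measurable_funM;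
    [exact: measurable_gamma_kernel | mfun].
- apply: aeW => x Dx.
  rewrite (_ : series _ = fun n => gamma_kernel a x * series (exp_coeff (y * x)) n).
    by apply: cvgMr; exact: series_exp_coeff_cvg.
  by apply/funext => n; exact: seriesE.
- apply: aeW => x Dx n; rewrite seriesE// normrM ger0_norm ?gamma_kernel_ge0//.
  rewrite ler_wpM2l ?gamma_kernel_ge0// (le_trans (normr_series_exp_coeff _ _))//.
  have := Dpos _ Dx; rewrite /= in_itv/= andbT => x0.
  by rewrite normrM (gtr0_norm x0).
Qed.

End exponential_series.

(** * Mixtures of gamma distribution functions *)

Section gamma_mixture.
Context {R : realType}.
Local Notation mu := (@lebesgue_measure R).

Lemma gbinom_gamma_cdf (a x : R) (k : nat) : 0 < a ->
  gbinom (a + k%:R - 1) k * gamma_cdf (a + k%:R) x =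
  (Gamma a)^-1 * (k`!%:R^-1 * \int[mu]_(t in `]0, x]) gamma_kernel (a + k%:R) t).
Proof.
move=> a0; rewrite gbinom_Gamma// /gamma_cdf.
rewrite -/(gamma_kernel _ _).
have Gk : Gamma (a + k%:R) != 0 by rewrite gt_eqF// Gamma_gt0// ltr_wpDr.
have Ga : Gamma a != 0 by rewrite gt_eqF// Gamma_gt0.
by field; rewrite Gk Ga pnatr_eq0 -lt0n fact_gt0.
Qed.

Lemma gamma_cdf_series (a x y : R) : 0 < a ->
  series (fun k => y ^+ k * (gbinom (a + k%:R - 1) k * gamma_cdf (a + k%:R) x))
    @ \oo -->
  (Gamma a)^-1 * \int[mu]_(t in `]0, x]) (gamma_kernel a t * expR (y * t)).
Proof.
move=> a0.
have sub : (`]0, x] : set R) `<=` `]0, +oo[ by exact: subset_itvl.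
have /(gamma_kernel_series a0 _ sub) : mu.-integrable (`]0, x] : set R)
    (EFin \o (fun t => gamma_kernel a t * expR (`|y| * t))).
  apply: (@le_integrable _ _ _ mu _ _ _
     (fun t => (expR (`|y| * x))%:E * (EFin \o gamma_kernel a) t)%E) => //.
  - apply: measurable_funTS; apply/measurable_EFinP; apply: measurable_funM.
      exact: measurable_gamma_kernel.
    by mfun.
  - move=> t /=; rewrite in_itv/= => /andP[t0 tx].
    rewrite lee_fin (ger0_norm (mulr_ge0 (gamma_kernel_ge0 a t) (expR_ge0 _))).
    rewrite (ger0_norm (mulr_ge0 (expR_ge0 _) (gamma_kernel_ge0 a t))).
    by rewrite mulrC ler_wpM2r ?gamma_kernel_ge0// ler_expR ler_wpM2l.
  - apply: integrableZl => //.
    by apply: integrableS (integrable_gamma_kernel a0).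
move=> /(_ (measurable_itv _)) h.
have -> : series (fun k => y ^+ k *
    (gbinom (a + k%:R - 1) k * gamma_cdf (a + k%:R) x)) = fun n =>
    (Gamma a)^-1 * series (fun k => y ^+ k / k`!%:R *
      \int[mu]_(t in `]0, x]) gamma_kernel (a + k%:R) t) n.
  apply/funext => n; rewrite /series/= big_distrr/=; apply: eq_bigr => k _.
  by rewrite gbinom_gamma_cdf//; ring.
exact: cvgMr.
Qed.

Lemma gamma_cdf_ge0 (b x : R) : 0 < b -> 0 <= gamma_cdf b x.
Proof.
move=> b0; apply: mulr_ge0; first by rewrite invr_ge0 ltW// Gamma_gt0.
by apply: Rintegral_ge0 => t _; exact: gamma_kernel_ge0.
Qed.

Lemma gbinom_ge0 (a : R) (k : nat) : 0 < a -> 0 <= gbinom (a + k%:R - 1) k.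
Proof.
move=> a0; rewrite gbinom_Gamma// divr_ge0//.
  by rewrite ltW// Gamma_gt0// ltr_wpDr.
by rewrite mulr_ge0// ltW// Gamma_gt0.
Qed.

(** For [M >= 0] the terms are nonnegative, so the limit bounds the partial sums.
    With [M] a bound for [`|1 - v|], this dominates the mixture uniformly in
    [v]. *)
Lemma gamma_cdf_series_bounded (a x M : R) : 0 < a -> 0 <= M ->
  exists K, forall n, series (fun k => M ^+ k *
    (gbinom (a + k%:R - 1) k * gamma_cdf (a + k%:R) x)) n <= K.
Proof.
move=> a0 M0; have h := @gamma_cdf_series a x M a0.
eexists => n; apply: nondecreasing_cvgn_le; last by apply/cvg_ex; eexists; exact: h.
apply: nondecreasing_series => k _ _.
apply: mulr_ge0; first exact: exprn_ge0.
apply: mulr_ge0; first exact: gbinom_ge0.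
by apply: gamma_cdf_ge0; rewrite ltr_wpDr.
Qed.

Lemma Rintegral_gamma_scale (a v x : R) : 0 < v ->
  v `^ a * \int[mu]_(t in `]0, x]) (t `^ (a - 1) * expR (- (t * v))) =
  \int[mu]_(t in `]0, v * x]) gamma_kernel a t.
Proof.
move=> v0.
have E : *%R v @^-1` `]0, v * x]%classic = `]0, x]%classic :> set R.
  by apply/seteqP; split => t /=; rewrite !in_itv/= pmulr_rgt0// ler_pM2l.
rewrite /Rintegral (@ge0_integral_scale _ v `]0, v * x] (EFin \o gamma_kernel a))//;
  last 2 first.
- exact: measurable_EFin_gamma_kernel.
- by move=> t _; rewrite lee_fin gamma_kernel_ge0.
rewrite E.
have -> : (\int[mu]_(t in `]0%R, x]) (t `^ (a - 1) * expR (- (t * v)))%:E =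
    (v `^ (- a))%:E * (v%:E * \int[mu]_(t in `]0%R, x]) (gamma_kernel a (v * t))%:E))%E.
  rewrite muleA -EFinM -ge0_integralZl_EFin//.
  - apply: eq_integral => t; rewrite inE/= in_itv/= => /andP[t0 _].
    rewrite -EFinM; apply: (congr1 (@EFin R)).
    by rewrite -mulrA; exact: gamma_kernel_scale.
  - by move=> t _; rewrite lee_fin gamma_kernel_ge0.
  - apply: measurable_funTS; apply/measurable_EFinP.
    apply: (measurableT_comp (measurable_gamma_kernel a)).
    exact: mulrl_measurable.
  - by rewrite mulr_ge0 ?powR_ge0 ?ltW.
have fineZ (c : R) (u : \bar R) : 0 < c -> fine (c%:E * u)%E = c * fine u.
  move=> c0; case: u => [u| |]//; first by rewrite gt0_muley ?mulr0 ?lte_fin.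
  by rewrite gt0_muleNy ?mulr0 ?lte_fin.
rewrite fineZ ?powR_gt0// mulrA -powRD ?addrN ?powRr0 ?mul1r//.
by rewrite (gt_eqF v0) implybT.
Qed.

(** [gamma_cdf_series] with [y = 1 - v] leaves the rate [v] in the exponential; the
    substitution [v * t] restores the rate 1 and absorbs the factor [v ^ a]. *)
Lemma gamma_cdf_mixture (a v x : R) : 0 < a -> 0 < v ->
  series (fun k => v `^ a * (1 - v) ^+ k *
    (gbinom (a + k%:R - 1) k * gamma_cdf (a + k%:R) x)) @ \oo -->
  gamma_cdf a (v * x).
Proof.
move=> a0 v0; have h := @gamma_cdf_series a x (1 - v) a0.
have -> : gamma_cdf a (v * x) = v `^ a * ((Gamma a)^-1 *
    \int[mu]_(t in `]0, x]) (gamma_kernel a t * expR ((1 - v) * t))).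
  rewrite /gamma_cdf mulrCA; congr (_ * _).
  rewrite -[LHS]/(\int[mu]_(t in `]0, v * x]) gamma_kernel a t).
  rewrite -Rintegral_gamma_scale//; congr (_ * _); apply: eq_Rintegral => t _.
  by rewrite /gamma_kernel -mulrA -expRD; congr (_ * expR _); ring.
rewrite (_ : series _ = fun n => v `^ a * series (fun k => (1 - v) ^+ k *
    (gbinom (a + k%:R - 1) k * gamma_cdf (a + k%:R) x)) n).
  exact: cvgMr.
by apply/funext => n; rewrite /series/= big_distrr/=; apply: eq_bigr => k _; ring.
Qed.

(** The same computation as in [gamma_cdf_mixture] over the whole half-line, where
    [c > 0] is what makes the dominating function integrable. *)
Lemma negative_binomial_series (a c : R) : 0 < a -> 0 < c <= 1 ->
  series (fun k => c `^ a * (1 - c) ^+ k * gbinom (a + k%:R - 1) k) @ \oo --> (1 : R).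
Proof.
move=> a0 /andP[c0 c1].
have Ga : Gamma a != 0 by rewrite gt_eqF// Gamma_gt0.
have kE t : gamma_kernel a t * expR (`|1 - c| * t) =
    t `^ (a - 1) * expR (- (t * c)).
  rewrite ger0_norm ?subr_ge0// /gamma_kernel -mulrA -expRD.
  by congr (_ * expR _); ring.
have h : \int[mu]_(t in `]0, +oo[) (gamma_kernel a t * expR ((1 - c) * t)) =
    c `^ (- a) * Gamma a.
  rewrite /Rintegral -[RHS]/(fine (c `^ (- a) * Gamma a)%:E) EFinM -GammaE//.
  rewrite -gammaE_scale//; congr fine; apply: eq_integral => t _.
  by rewrite -kE ger0_norm ?subr_ge0.
have intg : mu.-integrable (`]0, +oo[ : set R)
    (EFin \o (fun t => gamma_kernel a t * expR (`|1 - c| * t))).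
  apply/integrableP; split.
    apply: measurable_funTS; apply/measurable_EFinP; apply: measurable_funM.
      exact: measurable_gamma_kernel.
    by mfun.
  under eq_integral.
    move=> t _.
    rewrite /= (ger0_norm (mulr_ge0 (gamma_kernel_ge0 a t) (expR_ge0 _))) kE.
    over.
  by rewrite gammaE_scale// GammaE// -EFinM ltry.
have := gamma_kernel_series a0 (measurable_itv _) (@subset_refl _ _) intg.
rewrite h => {}h.
rewrite (_ : series _ = fun n => (c `^ a / Gamma a) * series (fun k =>
    (1 - c) ^+ k / k`!%:R *
    \int[mu]_(t in `]0, +oo[) gamma_kernel (a + k%:R) t) n); last first.
  apply/funext => n; rewrite /series/= big_distrr/=; apply: eq_bigr => k _.
  rewrite gbinom_Gamma// -[X in _ = _ * (_ * X)]/(Gamma (a + k%:R)).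
  by field; rewrite Ga pnatr_eq0 -lt0n fact_gt0.
have E : (c `^ a / Gamma a) * (c `^ (- a) * Gamma a) = 1.
  by rewrite powRN; field; rewrite Ga gt_eqF ?powR_gt0.
by move: h => /(@cvgMr _ _ _ _ _ (c `^ a / Gamma a)); rewrite E.
Qed.

End gamma_mixture.

(** * Integration against a gamma law *)

Section density.
Context {R : realType} {d : measure_display} {T : measurableType d}.
Variables (nu mu : {measure set T -> \bar R}) (f : T -> R).
Hypotheses (mf : measurable_fun setT f) (f0 : forall x, 0 <= f x).
Hypothesis nuE : forall A, measurable A ->
  nu A = (\int[mu]_(x in A) (f x)%:E)%E.
Local Open Scope ereal_scope.

Import HBNNSimple.

(** True for indicators by hypothesis, hence for simple functions and, by
    monotone convergence, for nonnegative measurable functions. *)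
Lemma ge0_integral_density (g : T -> \bar R) : measurable_fun setT g ->
  (forall x, 0 <= g x) -> \int[nu]_x g x = \int[mu]_x (g x * (f x)%:E).
Proof.
move=> mg g0; pose h := nnsfun_approx measurableT mg.
have mfE : measurable_fun setT (EFin \o f) by exact/measurable_EFinP.
have gE x : (h n x)%:E @[n --> \oo] --> g x.
  by apply: (@cvg_nnsfun_approx _ _ _ setT measurableT g mg) => // y _; exact: g0.
have hS x m n : (m <= n)%N -> (h m x <= h n x)%R.
  by move=> mn; exact/lefP/nd_nnsfun_approx.
have mh n : measurable_fun setT (EFin \o h n).
  exact/measurable_EFinP/measurable_funP.
have -> : \int[nu]_x g x = limn (fun n => \int[nu]_x (h n x)%:E).
  rewrite -monotone_convergence//.
  - by apply: eq_integral => x _; apply/esym/cvg_lim => //; exact: gE.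
  - by move=> n x _; rewrite lee_fin.
  - by move=> x _ m n mn; rewrite lee_fin; exact: hS.
have -> : \int[mu]_x (g x * (f x)%:E) =
    limn (fun n => \int[mu]_x ((h n x)%:E * (f x)%:E)).
  rewrite -monotone_convergence//.
  - by apply: eq_integral => x _; apply/esym/cvg_lim => //; exact: cvgeZr.
  - by move=> n; exact: (emeasurable_funM (mh n) mfE).
  - by move=> n x _; rewrite mule_ge0// lee_fin.
  - by move=> x _ m n mn; rewrite lee_wpmul2r ?lee_fin//; exact: hS.
congr (limn _); apply/funext => n.
have -> : \int[nu]_x (h n x)%:E =
    \sum_(r \in range (h n)) (r%:E * nu (h n @^-1` [set r])).
  by rewrite integralT_nnsfun sintegralE.
under [RHS]eq_integral.
  move=> x _; rewrite [X in X%:E * _](fimfunE (h n)) -fsumEFin// ge0_mule_fsuml; last first.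
    by move=> r; exact: nnfun_muleindic_ge0.
  over.
rewrite ge0_integral_fsum//=; last 2 first.
- move=> r; apply: emeasurable_funM => //; apply/measurable_EFinP.
  exact: measurable_funM.
- move=> r x _; apply: mule_ge0; last by rewrite lee_fin.
  by rewrite EFinM nnfun_muleindic_ge0.
apply: eq_fsbigr => r; rewrite inE/= => -[t _ <-].
have ht0 : (0 <= h n t)%R by [].
rewrite nuE//.
rewrite -ge0_integralZl_EFin//; last 2 first.
- by move=> x _; rewrite lee_fin.
- exact: measurable_funTS.
rewrite [LHS]integral_mkcond; apply: eq_integral => x _.
rewrite patchE; case: ifPn => xh.
  by rewrite indicE xh mulr1.
by rewrite indicE (negbTE xh) mulr0 mul0e.
Qed.

End density.

Section gamma_law.
Context {R : realType} {d : measure_display} {T : measurableType d}.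
Variable P : probability T R.
Local Notation mu := (@lebesgue_measure R).
Local Open Scope ereal_scope.

Lemma gamma_density_ge0 (a x : R) : (0 < a)%R -> (0 <= gamma_density a x)%R.
Proof.
move=> a0; rewrite /gamma_density; case: ifP => // _.
by rewrite !mulr_ge0 ?expR_ge0 ?powR_ge0// invr_ge0 ltW// Gamma_gt0.
Qed.

Lemma gamma_densityE (a x : R) : (0 < x)%R ->
  gamma_density a x = ((Gamma a)^-1 * gamma_kernel a x)%R.
Proof. by move=> x0; rewrite /gamma_density x0 /gamma_kernel; ring. Qed.

Lemma measurable_gamma_density (a : R) : measurable_fun setT (@gamma_density R a).
Proof.
apply: measurable_fun_ifT => //.
- exact: measurable_fun_ltr.
- by mfun.
Qed.

Lemma ge0_expectation_gamma (X : {RV P >-> R}) (a : R) (g : R -> \bar R) :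
  (0 < a)%R -> has_density X (gamma_density a) ->
  measurable_fun setT g -> (forall x, 0 <= g x) ->
  \int[P]_w g (X w) =
  (Gamma a)^-1%:E * \int[mu]_(x in `]0%R, +oo[) (g x * (gamma_kernel a x)%:E).
Proof.
move=> a0 dX mg g0.
have mX : measurable_fun setT (X : T -> measurableTypeR R).
  exact: (measurable_funP X).
pose nu : {measure set (measurableTypeR R) -> \bar R} :=
  measure_function_pushforward__canonical__measure_function_Measure P mX.
transitivity (\int[nu]_x g x).
  by rewrite /nu/= ge0_integral_pushforward// => x _; exact: g0.
rewrite (@ge0_integral_density R _ (measurableTypeR R) nu mu _
  (measurable_gamma_density a) _ dX g mg g0); last first.
  by move=> x; exact: gamma_density_ge0.
rewrite -ge0_integralZl_EFin//; last 3 first.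
- by move=> x _; rewrite mule_ge0// lee_fin gamma_kernel_ge0.
- apply: emeasurable_funM; first exact: measurable_funTS.
  exact: measurable_EFin_gamma_kernel.
- by rewrite invr_ge0 ltW// Gamma_gt0.
rewrite [RHS]integral_mkcond; apply: eq_integral => x _; rewrite patchE.
case: ifPn => [|/negP]; rewrite inE/= in_itv/= andbT => x0.
  by rewrite gamma_densityE// EFinM muleCA.
by rewrite /gamma_density ifN ?mule0//; exact/negP.
Qed.

(** The one-dimensional case of the dilation identity: the law of [c * X] has a
    gamma density of rate [1 / c], and the exponential weight restores the
    rate 1. *)
Lemma gamma_rv_scale (X : {RV P >-> R}) (a c : R) (M : R -> \bar R) :
  (0 < a)%R -> has_density X (gamma_density a) -> (0 < c)%R ->
  measurable_fun setT M -> (forall x, 0 <= M x) ->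
  \int[P]_w (M (c * X w)%R * (expR ((1 - c) * X w))%:E) =
  (c `^ (- a))%:E * \int[P]_w M (X w).
Proof.
move=> a0 dX c0 mM M0.
have mMc : measurable_fun setT (fun x => M (c * x)%R).
  by apply: (measurableT_comp mM); exact: mulrl_measurable.
rewrite (@ge0_expectation_gamma X a (fun x => M (c * x)%R * (expR ((1 - c) * x))%:E))//;
  last 2 first.
- by apply: emeasurable_funM => //; mfun.
- by move=> x; rewrite mule_ge0// lee_fin expR_ge0.
rewrite (@ge0_expectation_gamma X a M)//.
rewrite (@ge0_integral_scale_pos _ c (fun x => M x * (gamma_kernel a x)%:E))//;
  last 2 first.
- apply: emeasurable_funM; first exact: measurable_funTS.
  exact: measurable_EFin_gamma_kernel.
- by move=> x _; rewrite mule_ge0// lee_fin gamma_kernel_ge0.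
rewrite muleCA; congr (_ * _); rewrite muleA -EFinM -ge0_integralZl_EFin//; last 3 first.
- by move=> x _; rewrite mule_ge0// lee_fin gamma_kernel_ge0.
- apply: measurable_funTS; apply: emeasurable_funM => //.
  apply/measurable_EFinP; apply: (measurableT_comp (measurable_gamma_kernel a)).
  exact: mulrl_measurable.
- by rewrite mulr_ge0 ?powR_ge0// ltW.
apply: eq_integral => x; rewrite inE/= in_itv/= andbT => x0.
rewrite -muleA [RHS]muleCA -!EFinM; congr (_ * _); apply: (congr1 (@EFin R)).
rewrite -[RHS]mulrA -gamma_kernel_scale// /gamma_kernel mulrCA -expRD.
by congr (_ * expR _)%R; ring.
Qed.

End gamma_law.

(** * Independence of a partial sum and a further observation *)

Section independence.
Context {R : realType} {d : measure_display} {T : measurableType d}.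
Variables (P : probability T R) (n : nat) (X : 'I_n -> {RV P >-> R}).
Hypothesis hindep : mutually_independent X.

(** Events that prescribe each [X j], [j \in s], separately: a pi-system
    generating the sigma-algebra of [(X j)_(j in s)]. *)
Definition cylinders (s : seq 'I_n) : set (set T) :=
  [set B | exists A : 'I_n -> set R, (forall j, measurable (A j)) /\
     B = \bigcap_(j in [set j | j \in s]) X j @^-1` A j].

Lemma measurable_RV_preimage (j : 'I_n) (A : set R) :
  measurable A -> measurable (X j @^-1` A).
Proof. by move=> mA; rewrite -[_ @^-1` _]setTI; exact: (measurable_funP (X j)). Qed.

Lemma cylinders_measurable s : cylinders s `<=` measurable.
Proof.
move=> _ [A [mA ->]]; apply: fin_bigcap_measurable => //.
by move=> j _; exact: measurable_RV_preimage.
Qed.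

Lemma cylinders_setT s : cylinders s setT.
Proof.
by exists (fun=> setT); split => //; apply/seteqP; split.
Qed.

Lemma cylinders_setI s : setI_closed (cylinders s).
Proof.
move=> _ _ [A [mA ->]] [B [mB ->]]; exists (fun j => A j `&` B j); split.
  by move=> j; exact: measurableI.
by rewrite -bigcapI.
Qed.

(** Both sides are finite measures in [B] that agree on a pi-system. *)
Lemma cylinders_indep s i A : i \notin s -> measurable A ->
  forall B, <<s cylinders s >> B ->
  P (B `&` X i @^-1` A) = (P B * P (X i @^-1` A))%E.
Proof.
move=> si mA B sB; set E := X i @^-1` A.
have mE : measurable E by exact: measurable_RV_preimage.
have PEfin : P E \is a fin_num by exact: fin_num_measure.
have cp : 0 <= fine (P E) by rewrite fine_ge0.
rewrite muleC.
pose m1 : {measure set T -> \bar R} := mrestr P mE.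
pose m2 : {measure set T -> \bar R} := mscale (NngNum cp) P.
suff : m1 B = m2 B by rewrite /m1 /m2 /= /mrestr /mscale/= fineK.
apply: (@g_sigma_algebra_measure_unique _ _ _ (cylinders s) _ (fun=> setT)) => //.
- exact: cylinders_measurable.
- by move=> _; exact: cylinders_setT.
- by rewrite bigcup_const.
- exact: cylinders_setI.
- move=> _ [A' [mA' ->]]; rewrite /m1 /m2 /= /mrestr /mscale/= fineK//.
  pose J := [set j in s]%SET.
  pose A2 j := if j == i then A else A' j.
  have mA2 j : measurable (A2 j) by rewrite /A2; case: ifP.
  have hs F : \bigcap_(j in [set j | j \in s]) (X j @^-1` F j) =
       \bigcap_(j in [set j | j \in J]) (X j @^-1` F j).
    by congr (\bigcap_(_ in _) _); apply/seteqP; split=> j /=; rewrite inE.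
  have E2 : \bigcap_(j in [set j | j \in s]) (X j @^-1` A' j) =
      \bigcap_(j in [set j | j \in J]) (X j @^-1` A2 j).
    rewrite hs; apply: eq_bigcapr => j /=; rewrite inE /A2.
    by case: eqP => // ->; rewrite (negbTE si).
  have E3 : \bigcap_(j in [set j | j \in s]) (X j @^-1` A' j) `&` E =
      \bigcap_(j in [set j | j \in (i |: J)%SET]) (X j @^-1` A2 j).
    rewrite E2 setIC; apply/seteqP; split => w /=.
      move=> [wE wJ] j /=; rewrite in_setU1 => /orP[/eqP->|]; last exact: wJ.
      by rewrite /A2 eqxx.
    move=> h; split; last by move=> j jJ; apply: h; rewrite /= in_setU1 jJ orbT.
    by have := h i; rewrite /= setU11 /A2 eqxx; apply.
  rewrite E3 E2 !hindep// big_setU1/=; last by rewrite inE.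
  by rewrite {1}/A2 eqxx.
- by move=> _; rewrite /m1/= /mrestr/= setTI ltey_eq PEfin.
Qed.

Definition sample_sum (s : seq 'I_n) (w : T) : R := \sum_(j <- s) X j w.
Definition sample_sqsum (s : seq 'I_n) (w : T) : R := \sum_(j <- s) X j w ^+ 2.

Lemma measurable_cylinder_RV s j : j \in s ->
  measurable_fun setT (X j : g_sigma_algebraType (cylinders s) -> R).
Proof.
move=> js _ A mA; rewrite setTI; apply: sub_sigma_algebra.
exists (fun k => if k == j then A else setT); split.
  by move=> k; case: ifP.
apply/seteqP; split => w /=; first by move=> wA k _ /=; case: eqP => [->|].
by move=> /(_ j js); rewrite eqxx.
Qed.

(** Outside [s] the observations are replaced by 0, so that all summands are
    measurable for the sigma-algebra of the cylinders over [s]. *)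
Lemma measurable_cylinder_sample_sum s :
  measurable_fun setT ((fun w => (sample_sum s w, sample_sqsum s w)) :
    g_sigma_algebraType (cylinders s) -> R * R).
Proof.
pose Y j : g_sigma_algebraType (cylinders s) -> R :=
  if j \in s then X j else cst 0.
have mY j : measurable_fun setT (Y j).
  by rewrite /Y; case: ifP => // js; exact: measurable_cylinder_RV.
rewrite (_ : (fun w => _) = fun w => (\sum_(j <- s) Y j w, \sum_(j <- s) Y j w ^+ 2)).
  apply: measurable_fun_pair; apply: measurable_sum => //.
  by move=> j; exact: measurable_funX.
apply/funext => w; congr (_, _); apply: eq_big_seq => j js; rewrite /Y js//.
Qed.

Lemma measurable_sample_sum s : measurable_fun setT (sample_sum s).
Proof. by apply: measurable_sum => j; exact: measurable_funP. Qed.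

Lemma measurable_sample_sqsum s : measurable_fun setT (sample_sqsum s).
Proof.
by apply: measurable_sum => j; apply: measurable_funX; exact: measurable_funP.
Qed.

Lemma sample_sum_indep s i (C : set (R * R)) (A : set R) : i \notin s ->
  measurable C -> measurable A ->
  P ((fun w => (sample_sum s w, sample_sqsum s w)) @^-1` C `&` X i @^-1` A) =
  (P ((fun w => (sample_sum s w, sample_sqsum s w)) @^-1` C) * P (X i @^-1` A))%E.
Proof.
move=> si mC mA; apply: (cylinders_indep si mA).
by have := @measurable_cylinder_sample_sum s measurableT _ mC; rewrite setTI.
Qed.

End independence.

Section independent_tonelli.
Context {R : realType} {d d1 d2 : measure_display} {T : measurableType d}.
Context {T1 : measurableType d1} {T2 : measurableType d2}.
Variables (P : probability T R) (Y : {mfun T >-> T1}) (Z : {mfun T >-> T2}).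
Hypothesis YZ : forall A B, measurable A -> measurable B ->
  P (Y @^-1` A `&` Z @^-1` B) = (P (Y @^-1` A) * P (Z @^-1` B))%E.
Local Open Scope ereal_scope.

(** The joint law of [Y] and [Z] is the product of their laws; [v] below is an
    independent copy of the outcome [w]. *)
Lemma ge0_expectation_indep (f : T1 * T2 -> \bar R) :
  measurable_fun setT f -> (forall p, 0 <= f p) ->
  \int[P]_w f (Y w, Z w) = \int[P]_w \int[P]_v f (Y w, Z v).
Proof.
move=> mf f0.
have mYZ : measurable_fun setT (fun w => (Y w, Z w)).
  by apply: measurable_fun_pair; exact: measurable_funP.
pose m' : {measure set (T1 * T2) -> \bar R} :=
  measure_function_pushforward__canonical__measure_function_Measure P mYZ.
have mE : forall A, measurable A -> (distribution P Y \x distribution P Z) A = m' A.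
  apply: product_measure_unique => A B mA mB.
  by rewrite /m'/= /pushforward -YZ.
transitivity (\int[m']_p f p).
  by rewrite /m'/= ge0_integral_pushforward// => p _; exact: f0.
transitivity (\int[distribution P Y \x distribution P Z]_p f p).
  by apply: eq_measure_integral => A mA _; apply: esym; exact: mE.
rewrite fubini_tonelli1// ge0_integral_distribution//; last 2 first.
- exact: measurable_fun_fubini_tonelli_F.
- by move=> y; apply: integral_ge0 => z _; exact: f0.
apply: eq_integral => w _ /=; rewrite /fubini_F ge0_integral_distribution//.
exact: measurable_fun_pair2.
Qed.

Lemma measurable_fun_mfun_prod (f : T1 * T2 -> \bar R) : measurable_fun setT f ->
  measurable_fun setT (fun p : T * T => f (Y p.1, Z p.2)).
Proof.
move=> mf; apply: (measurableT_comp mf); apply: measurable_fun_pair.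
- exact: (measurableT_comp (measurable_funP Y) measurable_fst).
- exact: (measurableT_comp (measurable_funP Z) measurable_snd).
Qed.

Lemma ge0_expectation_indepC (f : T1 * T2 -> \bar R) :
  measurable_fun setT f -> (forall p, 0 <= f p) ->
  \int[P]_w f (Y w, Z w) = \int[P]_v \int[P]_w f (Y w, Z v).
Proof.
move=> mf f0; rewrite ge0_expectation_indep//.
apply: (@fubini_tonelli _ _ _ _ _ P P (fun p => f (Y p.1, Z p.2))) => //.
exact: measurable_fun_mfun_prod.
Qed.

End independent_tonelli.

(** * Dilation of a gamma sample *)

Section gamma_sum_scale.
Context {R : realType} {d : measure_display} {T : measurableType d}.
Variables (P : probability T R) (n : nat) (X : 'I_n -> {RV P >-> R}) (alpha : R).
Hypothesis hindep : mutually_independent X.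
Hypothesis halpha : 0 < alpha.
Hypothesis hdens : forall i, has_density (X i) (gamma_density alpha).
Local Open Scope ereal_scope.

(** Induction on the sample: conditionally on the other observations the new one
    is dilated by [gamma_rv_scale], and conditionally on the new one the others are
    dilated by the induction hypothesis, applied to [L] translated by the new
    observation. *)
Lemma gamma_sum_scale (s : seq 'I_n) (c : R) (L : R * R -> \bar R) :
  uniq s -> (0 < c)%R -> measurable_fun setT L -> (forall p, 0 <= L p) ->
  \int[P]_w (L (c * sample_sum X s w, c ^+ 2 * sample_sqsum X s w)%R
             * (expR ((1 - c) * sample_sum X s w))%:E) =
  (c `^ (- (alpha * (size s)%:R)))%:E *
  \int[P]_w L (sample_sum X s w, sample_sqsum X s w).
Proof.
move=> us c0; elim: s us L => [_ L mL L0|i s IH /= /andP[si us] L mL L0].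
  rewrite mulr0 oppr0 powRr0 mul1e; apply: eq_integral => w _.
  by rewrite /sample_sum /sample_sqsum !big_nil !mulr0 expR0 mule1.
pose Yf w := (sample_sum X s w, sample_sqsum X s w).
have mY : measurable_fun setT Yf.
  apply: measurable_fun_pair; first exact: measurable_sample_sum.
  exact: measurable_sample_sqsum.
pose Y : {mfun T >-> (R * R)%type} := HB.pack Yf (isMeasurableFun.Build _ _ _ _ Yf mY).
have YZ A B : measurable A -> measurable B ->
    P (Y @^-1` A `&` X i @^-1` B) = P (Y @^-1` A) * P (X i @^-1` B).
  exact: sample_sum_indep.
have mLc (f g : (R * R) * R -> R) : measurable_fun setT f -> measurable_fun setT g ->
    measurable_fun setT (fun p => L (f p, g p)).
  by move=> mf mg; apply: (measurableT_comp mL); exact: measurable_fun_pair.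
have m11 : measurable_fun setT (fun p : (R * R) * R => p.1.1).
  exact: (measurableT_comp measurable_fst measurable_fst).
have m12 : measurable_fun setT (fun p : (R * R) * R => p.1.2).
  exact: (measurableT_comp measurable_snd measurable_fst).
pose f1 (p : (R * R) * R) := L (c * (p.2 + p.1.1), c ^+ 2 * (p.2 ^+ 2 + p.1.2))%R *
  (expR ((1 - c) * (p.2 + p.1.1)))%:E.
pose f2 (p : (R * R) * R) := L (p.2 + c * p.1.1, p.2 ^+ 2 + c ^+ 2 * p.1.2)%R *
  (expR ((1 - c) * p.1.1))%:E.
pose f3 (p : (R * R) * R) := L (p.2 + p.1.1, p.2 ^+ 2 + p.1.2)%R.
have mf1 : measurable_fun setT f1 by apply: emeasurable_funM; [apply: mLc; mfun|mfun].
have mf2 : measurable_fun setT f2 by apply: emeasurable_funM; [apply: mLc; mfun|mfun].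
have mf3 : measurable_fun setT f3 by apply: mLc; mfun.
have f10 p : 0 <= f1 p by rewrite mule_ge0// lee_fin expR_ge0.
have f20 p : 0 <= f2 p by rewrite mule_ge0// lee_fin expR_ge0.
have f30 p : 0 <= f3 p by exact: L0.
transitivity (\int[P]_w f1 (Y w, X i w)).
  by apply: eq_integral => w _; rewrite /sample_sum /sample_sqsum !big_cons.
have -> : \int[P]_w L (sample_sum X (i :: s) w, sample_sqsum X (i :: s) w) =
    \int[P]_w f3 (Y w, X i w).
  by apply: eq_integral => w _; rewrite /sample_sum /sample_sqsum !big_cons.
rewrite (ge0_expectation_indep YZ mf1 f10).
transitivity (\int[P]_w ((c `^ (- alpha))%:E * \int[P]_v f2 (Y w, X i v))).
  apply: eq_integral => w _.
  have mM : measurable_fun setT (fun x => f2 (Y w, x)) by exact: measurable_fun_pair2.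
  rewrite -(gamma_rv_scale halpha (hdens i) c0 mM)//.
  apply: eq_integral => v _; rewrite /f1 /f2/= -muleA -EFinM -expRD.
  by congr (L (_, _) * (expR _)%:E); ring.
rewrite ge0_integralZl_EFin ?powR_ge0//; last 2 first.
- by move=> w _; exact: integral_ge0.
- apply: (@measurable_fun_fubini_tonelli_F _ _ _ _ _ P
    (fun p => f2 (Y p.1, X i p.2))) => //.
  exact: measurable_fun_mfun_prod.
rewrite -(ge0_expectation_indep YZ mf2 f20) (ge0_expectation_indepC YZ mf2 f20).
rewrite (ge0_expectation_indepC YZ mf3 f30).
have -> : (c `^ (- (alpha * (size s).+1%:R)))%:E =
    (c `^ (- alpha))%:E * (c `^ (- (alpha * (size s)%:R)))%:E.
  rewrite -EFinM -powRD; last by rewrite (gt_eqF c0) implybT.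
  by rewrite -natr1 mulrDr mulr1 opprD addrC.
rewrite -muleA; congr (_ * _).
rewrite -ge0_integralZl_EFin ?powR_ge0//; last 2 first.
- by move=> w _; exact: integral_ge0.
- apply: (@measurable_fun_fubini_tonelli_G _ _ _ _ _ P
    (fun p => f3 (Y p.1, X i p.2))) => //.
  exact: measurable_fun_mfun_prod.
apply: eq_integral => v _; rewrite /f2 /f3 /=.
apply: (IH us (fun p => L (X i v + p.1, X i v ^+ 2 + p.2)%R)) => //.
by apply: (measurableT_comp mL); apply: measurable_fun_pair; mfun.
Qed.

End gamma_sum_scale.

(** * Polar coordinates *)

(** The product of the density inserted in [integral_polar] with the weights that
    the dilation by [t] produces. *)
Lemma polar_kernel (R : realType) (b t s : R) : 0 < t -> 0 < s ->
  t `^ b * ((t * s) `^ (- b) * (t `^ (b - 1) * expR (- (t * (t * s) `^ (- 1)))) *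
    expR ((1 - t) * s)) =
  s `^ (- b) * expR (s + - (s `^ (- 1))) * (t `^ (b - 1) * expR (- (t * s))).
Proof.
move=> t0 s0; rewrite !powRM ?ltW// !powR_inv1 ?ltW//.
have -> : t * (t^-1 * s^-1) = s^-1 by field; rewrite !gt_eqF.
have -> : expR ((1 - t) * s) = expR s * expR (- (t * s)).
  by rewrite -expRD; congr expR; ring.
rewrite [t `^ (- b)]powRN expRD; field; by rewrite gt_eqF// powR_gt0.
Qed.

(** What the density inserted in [integral_polar] and the dilation weights leave
    for a sample with sum [s], once its ray is parametrised by the sum. *)
Definition polar_weight (R : realType) (b s : R) : R :=
  s `^ (- b) * s `^ (- b) * expR (s + - (s `^ (- 1))).

Lemma polar_weight_scale (R : realType) (b t s : R) : 0 < t -> 0 < s ->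
  s `^ (- b) * expR (s + - (s `^ (- 1))) * (t `^ (b - 1) * expR (- (t * s))) =
  polar_weight b s * s * gamma_kernel b (s * t).
Proof.
move=> t0 s0; rewrite (gamma_kernel_scale b s0 t0) /polar_weight.
set A := expR _; set B := gamma_kernel _ _; set C := s `^ _.
ring.
Qed.

Section polar.
Context {R : realType} {d : measure_display} {T : measurableType d}.
Variables (P : probability T R) (S Q : T -> R) (b : R).
Hypotheses (mS : measurable_fun setT S) (mQ : measurable_fun setT Q).
Hypothesis b0 : 0 < b.
Hypothesis S0 : {ae P, forall w, 0 < S w}.
Hypothesis hscale : forall (c : R) (L : R * R -> \bar R), 0 < c ->
  measurable_fun setT L -> (forall p, (0 <= L p)%E) ->
  (\int[P]_w (L (c * S w, c ^+ 2 * Q w)%R * (expR ((1 - c) * S w))%:E) =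
   (c `^ (- b))%:E * \int[P]_w L (S w, Q w))%E.
Local Notation mu := (@lebesgue_measure R).
Local Notation pos := (`]0%R, +oo[%classic : set R).
Local Open Scope ereal_scope.

Let mS1 : measurable_fun setT (fun p : T * R => S p.1).
Proof. exact: (measurableT_comp mS measurable_fst). Qed.

Let mQ1 : measurable_fun setT (fun p : T * R => Q p.1).
Proof. exact: (measurableT_comp mQ measurable_fst). Qed.

(** When [S w > 0], [(s, (s / S w) ^+ 2 * Q w)] runs through the values of the sum
    and of the sum of squares on the ray of the sample [w]; the reciprocal is
    written as a power to share the measurability lemmas. *)
Definition polar_integral (F : R * R -> \bar R) (w : T) : \bar R :=
  \int[mu]_(s in pos)
    (F (s, (s * S w `^ (- 1)) ^+ 2 * Q w)%R * (gamma_kernel b s)%:E).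

Lemma polar_integral_ge0 (F : R * R -> \bar R) (w : T) :
  (forall p, 0 <= F p) -> 0 <= polar_integral F w.
Proof.
by move=> F0; apply: integral_ge0 => s _; rewrite mule_ge0// lee_fin gamma_kernel_ge0.
Qed.

Let measurable_comp_pair (F : R * R -> \bar R) (f g : T * R -> R) :
  measurable_fun setT F -> measurable_fun setT f -> measurable_fun setT g ->
  measurable_fun setT (fun p => F (f p, g p)).
Proof.
by move=> mF mf mg; apply: (measurableT_comp mF); exact: measurable_fun_pair.
Qed.

Let measurable_polar_integrand (F : R * R -> \bar R) : measurable_fun setT F ->
  measurable_fun setT (fun p : T * R =>
    F (p.2, (p.2 * S p.1 `^ (- 1)) ^+ 2 * Q p.1)%R * (gamma_kernel b p.2)%:E).
Proof.
move=> mF; apply: emeasurable_funM; last by rewrite /gamma_kernel; mfun.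
by apply: measurable_comp_pair => //; mfun.
Qed.

Lemma measurable_polar_integral (F : R * R -> \bar R) :
  measurable_fun setT F -> (forall p, 0 <= F p) ->
  measurable_fun setT (fun w => (polar_weight b (S w))%:E * polar_integral F w).
Proof.
move=> mF F0; apply: emeasurable_funM; first by rewrite /polar_weight; mfun.
apply: (measurable_integral_on mu _ (measurable_polar_integrand mF)) => // p.
by rewrite mule_ge0// lee_fin gamma_kernel_ge0.
Qed.

(** Insert [Gamma b = \int[mu]_(t > 0) t ^ (b - 1) * S ^ (- b) * exp (- t / S)],
    which is [gammaE_scale], exchange the integrals, dilate the sample by [t] for
    each [t], exchange the integrals again and substitute [s = t * S]. *)
Lemma integral_polar (F : R * R -> \bar R) :
  measurable_fun setT F -> (forall p, 0 <= F p) ->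
  (Gamma b)%:E * \int[P]_w F (S w, Q w) =
  \int[P]_w ((polar_weight b (S w))%:E * polar_integral F w).
Proof.
move=> mF F0; have mFc := measurable_comp_pair mF.
have mFw : measurable_fun setT (fun w => F (S w, Q w)).
  by apply: (measurableT_comp mF); exact: measurable_fun_pair.
pose phi (p : T * R) := F (S p.1, Q p.1) *
  (S p.1 `^ (- b) * (p.2 `^ (b - 1) * expR (- (p.2 * S p.1 `^ (- 1)))))%:E.
pose psi (p : T * R) := F (p.2 * S p.1, p.2 ^+ 2 * Q p.1)%R *
  (S p.1 `^ (- b) * expR (S p.1 + - (S p.1 `^ (- 1))) *
     (p.2 `^ (b - 1) * expR (- (p.2 * S p.1))))%:E.
have mphi : measurable_fun setT phi by apply: emeasurable_funM; [apply: mFc|]; mfun.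
have mpsi : measurable_fun setT psi by apply: emeasurable_funM; [apply: mFc|]; mfun.
have phi0 p : 0 <= phi p by rewrite mule_ge0// lee_fin !mulr_ge0 ?powR_ge0 ?expR_ge0.
have psi0 p : 0 <= psi p by rewrite mule_ge0// lee_fin !mulr_ge0 ?powR_ge0 ?expR_ge0.
have S1 w : (0 < S w)%R -> (0 < S w `^ (- 1))%R by exact: powR_gt0.
rewrite -ge0_integralZl_EFin//; last by rewrite ltW// Gamma_gt0.
(* [S w] is fixed, and [gammaE_scale] has rate [1 / S w] *)
transitivity (\int[P]_w \int[mu]_(t in pos) phi (w, t)).
  apply: ge0_ae_eq_integral => //.
  - by apply: emeasurable_funM => //; exact: measurable_cst.
  - exact: (measurable_integral_on mu).
  - by move=> w _; rewrite mule_ge0// lee_fin ltW// Gamma_gt0.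
  - by move=> w _; exact: integral_ge0.
  apply: filterS S0 => w Sw _; rewrite /phi/=.
  have Sb : (S w `^ (- b) * (S w `^ (- 1)) `^ (- b) = 1)%R.
    by rewrite -powRrM mulN1r opprK powRN mulVf// gt_eqF// powR_gt0.
  rewrite ge0_integralZl//.
  - under eq_integral do rewrite EFinM.
    rewrite ge0_integralZl_EFin ?powR_ge0//.
    + by rewrite gammaE_scale ?S1// GammaE// -!EFinM mulrA Sb mul1r muleC.
    + by move=> t _; rewrite lee_fin mulr_ge0 ?powR_ge0 ?expR_ge0.
    + by apply: measurable_funTS; mfun.
  - by apply: measurable_funTS; mfun.
  - by move=> t _; rewrite lee_fin !mulr_ge0 ?powR_ge0 ?expR_ge0.
rewrite (@tonelli_on _ _ _ _ _ P mu setT pos phi)//.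
(* [t] is fixed, and the sample is dilated by [t] *)
transitivity (\int[mu]_(t in pos) \int[P]_w psi (w, t)).
  apply: eq_integral => t; rewrite inE/= in_itv/= andbT => t0.
  pose L (p : R * R) := F p *
    (p.1 `^ (- b) * (t `^ (b - 1) * expR (- (t * p.1 `^ (- 1)))))%:E.
  have mL : measurable_fun setT L by apply: emeasurable_funM => //; mfun.
  have L0 p : 0 <= L p by rewrite mule_ge0// lee_fin !mulr_ge0 ?powR_ge0 ?expR_ge0.
  have -> : \int[P]_w phi (w, t) = (t `^ b)%:E *
      \int[P]_w (L (t * S w, t ^+ 2 * Q w)%R * (expR ((1 - t) * S w))%:E).
    rewrite hscale// muleA -EFinM powRN mulfV ?mul1e//.
    by rewrite gt_eqF// powR_gt0.
  have mL1 : measurable_fun setT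
      (fun w => L (t * S w, t ^+ 2 * Q w)%R * (expR ((1 - t) * S w))%:E).
    apply: emeasurable_funM; last by mfun.
    by apply: (measurableT_comp mL); apply: measurable_fun_pair; mfun.
  rewrite -ge0_integralZl_EFin ?powR_ge0//; last first.
    by move=> w _; rewrite mule_ge0// lee_fin expR_ge0.
  apply: ge0_ae_eq_integral => //.
  - by apply: emeasurable_funM => //; exact: measurable_cst.
  - exact: measurable_fun_pair1.
  - move=> w _; apply: mule_ge0; first by rewrite lee_fin powR_ge0.
    by rewrite mule_ge0// lee_fin expR_ge0.
  apply: filterS S0 => w Sw _; rewrite /L /psi/=.
  rewrite -muleA -EFinM muleCA -EFinM; congr (_ * _%:E).
  exact: polar_kernel.
rewrite -(@tonelli_on _ _ _ _ _ P mu setT pos psi)//.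
apply: ge0_ae_eq_integral => //.
- exact: (measurable_integral_on mu).
- exact: measurable_polar_integral.
- by move=> w _; exact: integral_ge0.
- move=> w _; rewrite mule_ge0 ?lee_fin ?mulr_ge0 ?powR_ge0 ?expR_ge0//.
  exact: polar_integral_ge0.
apply: filterS S0 => w Sw _; rewrite /psi/=.
rewrite /polar_integral; have mh : measurable_fun setT (fun s : R =>
    F (s, (s * S w `^ (- 1)) ^+ 2 * Q w)%R * (gamma_kernel b s)%:E).
  exact: (measurable_fun_pair2 w (measurable_polar_integrand mF)).
rewrite (@ge0_integral_scale_pos _ (S w) (fun s =>
    F (s, (s * S w `^ (- 1)) ^+ 2 * Q w)%R * (gamma_kernel b s)%:E))//; last 2 first.
- exact: measurable_funTS.
- by move=> s _; rewrite mule_ge0// lee_fin gamma_kernel_ge0.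
rewrite muleA -EFinM -ge0_integralZl_EFin//; last 3 first.
- by move=> s _; rewrite mule_ge0// lee_fin gamma_kernel_ge0.
- by apply: measurable_funTS; apply: (measurableT_comp mh); exact: mulrl_measurable.
- by rewrite !mulr_ge0 ?powR_ge0 ?expR_ge0// ltW.
apply: eq_integral => t; rewrite inE/= in_itv/= andbT => t0.
rewrite [RHS]muleCA -EFinM; congr (F (_, _) * _%:E).
- by rewrite mulrC.
- by rewrite powR_inv1 ?(ltW Sw)//; field; rewrite gt_eqF.
- exact: polar_weight_scale.
Qed.

End polar.

(** * The law of the norm *)

Section incomplete_gamma.
Context {R : realType}.
Local Notation mu := (@lebesgue_measure R).
Local Notation pos := (`]0%R, +oo[%classic : set R).
Local Open Scope ereal_scope.

Lemma integral_gamma_kernelZ (b : R) (k : \bar R) : (0 < b)%R -> 0 <= k ->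
  \int[mu]_(t in pos) (k * (gamma_kernel b t)%:E) = k * (Gamma b)%:E.
Proof.
move=> b0 k0; rewrite ge0_integralZl//; last 2 first.
- exact: measurable_EFin_gamma_kernel.
- by move=> s _; rewrite lee_fin gamma_kernel_ge0.
by rewrite -(GammaE b0).
Qed.

(** The incomplete gamma integral over a domain that does not depend on [x], which
    makes its measurability in [x] a case of Tonelli. *)
Definition gamma_lowerE (b x : R) : \bar R :=
  \int[mu]_(t in pos) (if (t <= x)%R then gamma_kernel b t else 0%R)%:E.

Let measurable_trunc (b : R) : measurable_fun setT
  (fun p : R * R => (if (p.2 <= p.1)%R then gamma_kernel b p.2 else 0%R)%:E).
Proof.
apply/measurable_EFinP; apply: measurable_fun_ifT => //.
- exact: measurable_fun_ler.
- exact: (measurableT_comp (measurable_gamma_kernel b) measurable_snd).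
Qed.

Let trunc_ge0 (b x t : R) :
  0 <= (if (t <= x)%R then gamma_kernel b t else 0%R)%:E.
Proof. by rewrite lee_fin; case: ifP => // _; exact: gamma_kernel_ge0. Qed.

Lemma gamma_lowerE_ge0 b x : 0 <= gamma_lowerE b x.
Proof. by apply: integral_ge0 => t _; exact: trunc_ge0. Qed.

Lemma measurable_gamma_lowerE b : measurable_fun setT (gamma_lowerE b).
Proof.
by apply: (measurable_integral_on mu _ (@measurable_trunc b)) => // p; exact: trunc_ge0.
Qed.

Lemma gamma_lowerE_cdf (b x : R) : (0 < b)%R ->
  gamma_lowerE b x = (Gamma b * gamma_cdf b x)%:E.
Proof.
move=> b0.
have -> : gamma_lowerE b x = \int[mu]_(t in `]0%R, x]) (gamma_kernel b t)%:E.
  rewrite /gamma_lowerE [LHS]integral_mkcond [RHS]integral_mkcond.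
  apply: eq_integral => t _; rewrite !patchE.
  have -> : (t \in pos) = (0 < t)%R.
    by apply/idP/idP; rewrite inE/= in_itv/= andbT.
  have -> : (t \in `]0%R, x]%classic) = (0 < t <= x)%R.
    by apply/idP/idP; rewrite inE/= in_itv/=.
  by case: (0 < t)%R; case: (t <= x)%R.
rewrite /gamma_cdf mulVKf; last by rewrite gt_eqF// Gamma_gt0.
rewrite /Rintegral fineK//.
apply: integrable_fin_num => //.
by apply: integrableS (integrable_gamma_kernel b0) => //; exact: subset_itvl.
Qed.

Lemma measurable_gamma_cdf (b : R) : (0 < b)%R ->
  measurable_fun setT (@gamma_cdf R b).
Proof.
move=> b0.
rewrite (_ : gamma_cdf b = fun x => (Gamma b)^-1 * fine (gamma_lowerE b x))%R.
  apply: measurable_funM; first exact: measurable_cst.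
  exact: (measurableT_comp (fine_measurable measurableT) (measurable_gamma_lowerE b)).
by apply/funext => x; rewrite gamma_lowerE_cdf//= mulKf// gt_eqF// Gamma_gt0.
Qed.

End incomplete_gamma.

Section radial_cdf.
Context {R : realType} {d : measure_display} {T : measurableType d}.
Variables (P : probability T R) (S Q : T -> R) (b : R).
Hypotheses (mS : measurable_fun setT S) (mQ : measurable_fun setT Q).
Hypothesis b0 : 0 < b.
Hypothesis S0 : {ae P, forall w, 0 < S w}.
Hypothesis Q0 : {ae P, forall w, 0 < Q w}.
Hypothesis hscale : forall (c : R) (L : R * R -> \bar R), 0 < c ->
  measurable_fun setT L -> (forall p, (0 <= L p)%E) ->
  (\int[P]_w (L (c * S w, c ^+ 2 * Q w)%R * (expR ((1 - c) * S w))%:E) =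
   (c `^ (- b))%:E * \int[P]_w L (S w, Q w))%E.
Local Notation mu := (@lebesgue_measure R).
Local Notation pos := (`]0%R, +oo[%classic : set R).

Lemma radial_cond (r q u s : R) : 0 < r -> 0 < q -> 0 < u -> 0 < s ->
  ((s * u `^ (- 1)) ^+ 2 * q <= r ^+ 2) = (s <= r * (u * q `^ (- 2^-1))).
Proof.
move=> r0 q0 u0 s0; rewrite (powR_inv1 (ltW u0)) powRN (powR12_sqrt (ltW q0)).
have sq : 0 < Num.sqrt q by rewrite sqrtr_gt0.
rewrite -{1}(sqr_sqrtr (ltW q0)) -exprMn ler_pXn2r ?nnegrE ?(ltW r0)//; last first.
  by rewrite !mulr_ge0 ?invr_ge0 ?(ltW u0) ?(ltW s0) ?(ltW sq).
by rewrite mulrA ler_pdivlMr// mulrAC ler_pdivrMr.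
Qed.

Lemma radial_homogeneous (q u s : R) : 0 < q -> 0 < u -> 0 < s ->
  s * ((s * u `^ (- 1)) ^+ 2 * q) `^ (- 2^-1) = u * q `^ (- 2^-1).
Proof.
move=> q0 u0 s0; have su : 0 < s / u by rewrite divr_gt0.
have sq : 0 < (s / u) ^+ 2 * q by rewrite mulr_gt0// exprn_gt0.
rewrite (powR_inv1 (ltW u0)) !powRN (powR12_sqrt (ltW q0)) (powR12_sqrt (ltW sq)).
rewrite sqrtrM ?sqr_ge0// sqrtr_sqr (gtr0_norm su).
by field; rewrite !gt_eqF// sqrtr_gt0.
Qed.

Local Open Scope ereal_scope.

(** [integral_polar] for the indicator [F1] of [q <= r ^+ 2] has, along the ray of
    [w], the incomplete gamma integral [F2 (S w, Q w)]. As [F2] is constant along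
    rays, [integral_polar] for [F2] has the same ray integral times [Gamma b].
    Comparing the two identities removes the weight. *)
Lemma radial_law (r : R) : (0 < r)%R ->
  \int[P]_w (gamma_cdf b (r * (S w * Q w `^ (- 2^-1))))%:E =
  P [set w | (Q w <= r ^+ 2)%R].
Proof.
move=> r0; have Gb : (0 < Gamma b)%R by exact: Gamma_gt0.
pose F1 (p : R * R) : \bar R := (if (p.2 <= r ^+ 2)%R then 1%R else 0%R)%:E.
pose F2 (p : R * R) := gamma_lowerE b (r * (p.1 * p.2 `^ (- 2^-1))).
have mF1 : measurable_fun setT F1.
  apply/measurable_EFinP; apply: measurable_fun_ifT => //.
  exact: (measurable_fun_ler measurable_snd).
have mF2 : measurable_fun setT F2.
  by apply: (measurableT_comp (measurable_gamma_lowerE b)); mfun.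
have F10 p : 0 <= F1 p by rewrite lee_fin; case: ifP.
have F20 p : 0 <= F2 p by exact: gamma_lowerE_ge0.
have canc (x y : \bar R) : (Gamma b)%:E * x = (Gamma b)%:E * y -> x = y.
  move=> h; rewrite -[x]mul1e -[y]mul1e.
  have -> : 1 = ((Gamma b)^-1)%:E * (Gamma b)%:E.
    by rewrite -EFinM mulVf// gt_eqF.
  by rewrite -!muleA h.
have I1 w : (0 < S w)%R -> (0 < Q w)%R -> polar_integral S Q b F1 w = F2 (S w, Q w).
  move=> Sw Qw; apply: eq_integral => s; rewrite inE/= in_itv/= andbT => s0.
  rewrite /F1/= radial_cond//.
  by case: ifP => _; rewrite ?mul1e ?mul0e.
have I2 w : (0 < S w)%R -> (0 < Q w)%R ->
    polar_integral S Q b F2 w = F2 (S w, Q w) * (Gamma b)%:E.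
  move=> Sw Qw; apply: etrans; last exact: (integral_gamma_kernelZ b0 (F20 (S w, Q w))).
  apply: eq_integral => s; rewrite inE/= in_itv/= andbT => s0.
  by rewrite /F2/= radial_homogeneous.
have W0 s : 0 <= (polar_weight b s)%:E.
  by rewrite lee_fin !mulr_ge0 ?powR_ge0 ?expR_ge0.
have E2 : \int[P]_w F2 (S w, Q w) = (Gamma b)%:E * \int[P]_w F1 (S w, Q w).
  apply: canc; rewrite !(integral_polar mS mQ b0 S0 hscale)//.
  rewrite -ge0_integralZl_EFin ?(ltW Gb)//; last 2 first.
  - by move=> w _; rewrite mule_ge0// polar_integral_ge0.
  - exact: measurable_polar_integral.
  apply: ge0_ae_eq_integral => //.
  - exact: measurable_polar_integral.
  - by apply: emeasurable_funM; [exact: measurable_cst|exact: measurable_polar_integral].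
  - by move=> w _; rewrite mule_ge0// polar_integral_ge0.
  - move=> w _; apply: mule_ge0; first by rewrite lee_fin ltW.
    by rewrite mule_ge0// polar_integral_ge0.
  apply: filterS2 S0 Q0 => w Sw Qw _.
  by rewrite I1// I2// muleA muleC.
have -> : P [set w | (Q w <= r ^+ 2)%R] = \int[P]_w F1 (S w, Q w).
  rewrite -[LHS]mul1e -integral_cst; last first.
    by rewrite -[X in measurable X]setTI; apply: measurable_fun_ler => //.
  rewrite [LHS]integral_mkcond; apply: eq_integral => w _.
  rewrite patchE /F1/=; case: ifPn => [|/negP]; rewrite inE/=; first by move=> ->.
  by move=> /negP/negbTE ->.
apply: canc; rewrite -E2 -ge0_integralZl_EFin ?(ltW Gb)//; last 2 first.
- by move=> w _; rewrite lee_fin gamma_cdf_ge0.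
- by apply/measurable_EFinP; apply: (measurableT_comp (measurable_gamma_cdf b0)); mfun.
by apply: eq_integral => w _; rewrite /F2 gamma_lowerE_cdf// EFinM.
Qed.

End radial_cdf.

(** * The angle of a sample *)

Section sample.
Context {R : realType}.

(** The sum of the squared deviations from the mean is the defect in the
    Cauchy-Schwarz inequality, whence both the inequality and its equality case. *)
Lemma sqr_sum_deviation (n : nat) (x : 'I_n.+1 -> R) :
  \sum_i (x i - (\sum_j x j) / n.+1%:R) ^+ 2 =
  \sum_i x i ^+ 2 - (\sum_i x i) ^+ 2 / n.+1%:R.
Proof.
set s := \sum_j x j; set N : R := n.+1%:R.
have N0 : N != 0 by rewrite pnatr_eq0.
under eq_bigr do rewrite sqrrB.
rewrite big_split/= sumrB.
rewrite sumr_const card_ord sumrMnl -mulr_suml -/s -[X in _ + X]mulr_natl -/N.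
by field.
Qed.

Lemma sqr_sum_le (n : nat) (x : 'I_n -> R) :
  (\sum_i x i) ^+ 2 <= n%:R * \sum_i x i ^+ 2.
Proof.
case: n x => [x|n x]; first by rewrite !big_ord0 expr0n mulr0.
rewrite -ler_pdivrMl ?ltr0n// mulrC -subr_ge0 -sqr_sum_deviation.
by apply: sumr_ge0 => i _; exact: sqr_ge0.
Qed.

Lemma sqr_sum_eq (n : nat) (x : 'I_n -> R) (i j : 'I_n) :
  (\sum_i x i) ^+ 2 = n%:R * \sum_i x i ^+ 2 -> x i = x j.
Proof.
case: n x i j => [x []//|n x i j] e.
have /eqP : \sum_i (x i - (\sum_j x j) / n.+1%:R) ^+ 2 = 0.
  by rewrite sqr_sum_deviation e mulrAC mulfV ?mul1r ?subrr// pnatr_eq0.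
rewrite psumr_eq0 => [/allP h|k _]; last exact: sqr_ge0.
have k0 k : x k = (\sum_j x j) / n.+1%:R.
  have := h k; rewrite mem_index_enum => /(_ isT).
  by rewrite /= sqrf_eq0 subr_eq0 => /eqP.
by rewrite (k0 i) (k0 j).
Qed.

(** The Cauchy-Schwarz inequality keeps the quotient in the domain of [acos]; for
    [x = 0] both sides are 0. *)
Lemma cos_angle_ones (n : nat) (x : 'I_n -> R) :
  cos (angle x (fun=> 1)) =
  (\sum_i x i) / (Num.sqrt (\sum_i x i ^+ 2) * Num.sqrt n%:R).
Proof.
rewrite /angle /dotp.
have -> : \sum_i x i * 1 = \sum_i x i by apply: eq_bigr => i _; rewrite mulr1.
have -> : \sum_(i < n) 1 * 1 = n%:R :> R.
  by under eq_bigr do rewrite mulr1; rewrite sumr_const card_ord.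
under [X in Num.sqrt X]eq_bigr do rewrite -expr2.
set s := \sum_i x i; set q := \sum_i x i ^+ 2.
have q0 : 0 <= q by apply: sumr_ge0 => i _; exact: sqr_ge0.
rewrite acosK// in_itv/= -ler_norml -sqrtrM//.
have [->|nq0] := eqVneq (Num.sqrt (q * n%:R)) 0; first by rewrite invr0 mulr0 normr0.
have nq : 0 < Num.sqrt (q * n%:R) by rewrite lt_def nq0 sqrtr_ge0.
rewrite normrM normfV (gtr0_norm nq) ler_pdivrMr// mul1r.
rewrite -(ler_sqr (normr_ge0 _)) ?nnegrE ?sqrtr_ge0// -normrX ger0_norm ?sqr_ge0//.
by rewrite sqr_sqrtr ?mulr_ge0// mulrC sqr_sum_le.
Qed.

End sample.

Section integrability.
Context {R : realType} {d : measure_display} {T : measurableType d}.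
Variable P : probability T R.

Lemma ae_bounded_integrable (f : T -> R) (K : R) : measurable_fun setT f ->
  {ae P, forall w, `|f w| <= K} -> P.-integrable setT (EFin \o f).
Proof.
move=> mf fK; apply/integrableP; split; first exact/measurable_EFinP.
have mfn : measurable_fun setT (fun w => `|(f w)%:E|%E).
  by apply: measurableT_comp => //; exact/measurable_EFinP.
apply: (@le_lt_trans _ _ (\int[P]_w (`|K|)%:E)%E).
  apply: ae_ge0_le_integral => //.
  by apply: filterS fK => w h _; rewrite lee_fin (le_trans h)// ler_norm.
rewrite integral_cst//= -ge0_fin_numE ?fin_numM ?fin_num_measure//.
by rewrite mule_ge0.
Qed.

Lemma ae_eq_Rintegral (f g : T -> R) :
  measurable_fun setT f -> measurable_fun setT g ->
  {ae P, forall w, f w = g w} -> \int[P]_w f w = \int[P]_w g w.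
Proof.
move=> mf mg fg; congr fine; apply: ae_eq_integral => //.
- exact/measurable_EFinP.
- exact/measurable_EFinP.
- by apply: filterS fg => w h _; rewrite h.
Qed.

Lemma Rintegral_gt0 (f : T -> R) (A : set T) :
  P.-integrable setT (EFin \o f) -> {ae P, forall w, 0 <= f w} ->
  measurable A -> (0 < P A)%E -> {ae P, forall w, A w -> f w != 0} ->
  0 < \int[P]_w f w.
Proof.
move=> intf f0 mA PA fA.
have mf : measurable_fun setT f by have /measurable_int/measurable_EFinP := intf.
have E : \int[P]_w f w = \int[P]_w `|f w|.
  apply: ae_eq_Rintegral => //; first exact: measurableT_comp.
  by apply: filterS f0 => w h; rewrite ger0_norm.
rewrite lt_def E Rintegral_ge0 ?andbT//; apply/eqP => I0.
have : (\int[P]_w `|(f w)%:E| = 0)%E.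
  rewrite -[LHS]fineK; first by rewrite -[fine _]/(\int[P]_w `|f w|) I0.
  by apply: integrable_fin_num => //; exact: integrable_norm intf.
move=> /ae_eq_integral_abs -/(_ measurableT) f00.
have : P.-negligible A.
  rewrite -[A]setCK; apply: filterS2 fA (f00 _) => [w fw h Aw|].
    by move/eqP: (fw Aw); apply; have [] := h I.
  exact/measurable_EFinP.
by move=> /negligibleP -/(_ mA) PA0; rewrite PA0 ltxx in PA.
Qed.

End integrability.

(** * The mixture representation *)

Section gamma_sample.
Context {R : realType} {d : measure_display} {T : measurableType d}.
Variables (P : probability T R) (n : nat) (X : 'I_n -> {RV P >-> R}) (alpha : R).
Hypotheses (hn : (2 <= n)%N) (halpha : 0 < alpha).
Hypothesis hindep : mutually_independent X.
Hypothesis hdens : forall i, has_density (X i) (gamma_density alpha).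
Local Notation mu := (@lebesgue_measure R).
Local Notation s := (index_enum 'I_n).
Local Notation S := (sample_sum X s).
Local Notation Q := (sample_sqsum X s).
Local Notation b := (alpha * n%:R).
Local Notation N := (Num.sqrt (n%:R : R)).

Let n0 : (0 < n)%N. Proof. exact: ltn_trans hn. Qed.
Let nR0 : 0 < n%:R :> R. Proof. by rewrite ltr0n. Qed.
Let N0 : 0 < N. Proof. by rewrite sqrtr_gt0. Qed.
Let b0 : 0 < b. Proof. by rewrite mulr_gt0. Qed.

Lemma gamma_rv_pos i : {ae P, forall w, 0 < X i w}.
Proof.
exists (X i @^-1` `]-oo, 0]); split.
- exact: measurable_RV_preimage.
- rewrite -[LHS]/(distribution P (X i) `]-oo, 0]) hdens//.
  apply: integral0_eq => x; rewrite /= in_itv/= => x0.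
  by rewrite /gamma_density ltNge x0.
- by move=> w /= /negP; rewrite in_itv/= -leNgt.
Qed.

Lemma sample_pos : {ae P, forall w, forall i, 0 < X i w}.
Proof. by apply: filter_forall => i; exact: gamma_rv_pos. Qed.

Lemma sample_sum_pos : {ae P, forall w, 0 < S w}.
Proof.
apply: filterS sample_pos => w h; rewrite /sample_sum (bigD1 (Ordinal n0))//=.
by rewrite ltr_wpDr// sumr_ge0// => i _; exact: ltW.
Qed.

Lemma sample_sqsum_pos : {ae P, forall w, 0 < Q w}.
Proof.
apply: filterS sample_pos => w h; rewrite /sample_sqsum (bigD1 (Ordinal n0))//=.
by rewrite ltr_wpDr ?exprn_gt0// sumr_ge0// => i _; exact: sqr_ge0.
Qed.

(** The random variable [sqrt n * cos Phi]. *)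
Definition norm_ratio (w : T) : R := S w * Q w `^ (- 2^-1).

Lemma measurable_norm_ratio : measurable_fun setT norm_ratio.
Proof.
apply: measurable_funM; first exact: measurable_sample_sum.
apply: (measurableT_comp (measurable_powR _)); exact: measurable_sample_sqsum.
Qed.

Lemma cos_Phi w : cos (Phi X w) = norm_ratio w / N.
Proof.
rewrite /Phi cos_angle_ones /norm_ratio powRN powR12_sqrt; first by rewrite invfM mulrA.
by apply: sumr_ge0 => i _; exact: sqr_ge0.
Qed.

Lemma norm_ratio_bounds : {ae P, forall w, 0 < norm_ratio w <= N}.
Proof.
apply: filterS2 sample_sum_pos sample_sqsum_pos => w Sw Qw; apply/andP; split.
  by rewrite mulr_gt0// powR_gt0.
rewrite /norm_ratio powRN powR12_sqrt ?(ltW Qw)// ler_pdivrMr ?sqrtr_gt0//.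
rewrite -(ler_sqr (ltW Sw)) ?nnegrE ?mulr_ge0 ?sqrtr_ge0// exprMn.
rewrite (sqr_sqrtr (ltW nR0)) (sqr_sqrtr (ltW Qw)).
exact: sqr_sum_le.
Qed.

Lemma radial_mixture (r : R) : 0 < r ->
  H_radial X r = \int[P]_w gamma_cdf b (r * norm_ratio w).
Proof.
move=> r0; rewrite /H_radial /Rintegral; congr fine; apply/esym.
have us : uniq s by exact: index_enum_uniq.
have ss : size s = n.
  rewrite -[RHS](size_enum_ord n); apply: perm_size; apply: uniq_perm => //.
    exact: enum_uniq.
  by move=> i; rewrite mem_index_enum mem_enum.
apply: (radial_law _ _ b0 sample_sum_pos sample_sqsum_pos _ r0).
- exact: measurable_sample_sum.
- exact: measurable_sample_sqsum.
- by move=> c L c0 mL L0; rewrite (gamma_sum_scale hindep halpha hdens us c0 mL L0) ss.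
Qed.

Lemma mu_momentE k : mu_moment X alpha k = \int[P]_w (norm_ratio w `^ (b + k%:R)).
Proof.
rewrite /mu_moment expectation.unlock /Rintegral; congr fine; apply: eq_integral => w _.
by rewrite cos_Phi mulrC divfK// gt_eqF.
Qed.

Lemma integrable_norm_ratio_powR (p : R) : 0 <= p ->
  P.-integrable setT (EFin \o (fun w => norm_ratio w `^ p)).
Proof.
move=> p0; apply: (@ae_bounded_integrable _ _ _ _ _ (N `^ p)).
  exact: (measurableT_comp (measurable_powR p) measurable_norm_ratio).
apply: filterS norm_ratio_bounds => w /andP[u0 uN].
by rewrite ger0_norm ?powR_ge0// ge0_ler_powR// nnegrE ltW.
Qed.

(** The integrand of [delta]; it equals
    [(cos Phi) ^ (alpha * n) * (1 - cos Phi) ^ k] for [lambda = sqrt n]. *)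
Definition mixand (lambda : R) (k : nat) (w : T) : R :=
  (norm_ratio w / lambda) `^ b * (1 - norm_ratio w / lambda) ^+ k.

Lemma measurable_mixand lambda k : measurable_fun setT (mixand lambda k).
Proof.
have mU : measurable_fun setT (fun w => norm_ratio w / lambda).
  by apply: measurable_funM; [exact: measurable_norm_ratio|exact: measurable_cst].
apply: measurable_funM.
  exact: (measurableT_comp (measurable_powR b) mU).
by apply: measurable_funX; apply: measurable_funB => //; exact: measurable_cst.
Qed.

Lemma mixand_expand lambda k w : 0 < lambda -> 0 < norm_ratio w ->
  mixand lambda k w = \sum_(j < k.+1) (-1) ^+ j * 'C(k, j)%:R *
    lambda `^ (- (b + j%:R)) * norm_ratio w `^ (b + j%:R).
Proof.
move=> l0 u0; rewrite /mixand exprBn big_distrr/=; apply: eq_bigr => j _.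
have v0 : 0 < norm_ratio w / lambda by rewrite divr_gt0.
rewrite expr1n mulr1 -(mulr_natl _ 'C(k, j)).
have -> : (-1) ^+ j * 'C(k, j)%:R * lambda `^ (- (b + j%:R)) *
      norm_ratio w `^ (b + j%:R) =
    (-1) ^+ j * 'C(k, j)%:R *
      ((norm_ratio w / lambda) `^ b * (norm_ratio w / lambda) ^+ j).
  rewrite -powR_mulrn ?(ltW v0)// -powRD; last by rewrite (gt_eqF v0) implybT.
  rewrite powRM ?invr_ge0 ?(ltW u0) ?(ltW l0)//.
  rewrite -[lambda^-1]powR_inv1 ?(ltW l0)// -powRrM mulN1r; ring.
ring.
Qed.

Lemma mixand_bounds lambda w : 0 < lambda -> 0 < norm_ratio w <= N ->
  0 <= (norm_ratio w / lambda) `^ b <= (N / lambda) `^ b /\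
  `|1 - norm_ratio w / lambda| <= 1 + N / lambda.
Proof.
move=> l0 /andP[u0 uN].
have v0 : 0 < norm_ratio w / lambda by rewrite divr_gt0.
have vN : norm_ratio w / lambda <= N / lambda by rewrite ler_pM2r ?invr_gt0.
split.
  rewrite powR_ge0/= ge0_ler_powR// ?nnegrE ?(ltW b0) ?(ltW v0)//.
  by rewrite (le_trans (ltW v0)).
by rewrite (le_trans (ler_normB _ _))// normr1 gtr0_norm// lerD2l.
Qed.

Lemma integrable_mixand lambda k : 0 < lambda ->
  P.-integrable setT (EFin \o mixand lambda k).
Proof.
move=> l0.
apply: (@ae_bounded_integrable _ _ _ _ _ ((N / lambda) `^ b * (1 + N / lambda) ^+ k)).
  exact: measurable_mixand.
apply: filterS norm_ratio_bounds => w uw.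
have [/andP[h1 h2] h3] := mixand_bounds l0 uw.
rewrite /mixand normrM normrX (ger0_norm h1).
by apply: ler_pM => //; rewrite ?exprn_ge0// lerXn2r ?nnegrE// (le_trans _ h3).
Qed.

Lemma deltaE lambda k : 0 < lambda ->
  delta X alpha k lambda = \int[P]_w mixand lambda k w.
Proof.
move=> l0.
pose c j := (-1) ^+ j * 'C(k, j)%:R * lambda `^ (- (b + j%:R)).
have bj j : 0 <= b + j%:R by rewrite addr_ge0// ltW.
have intc j : P.-integrable setT (EFin \o (fun w => c j * norm_ratio w `^ (b + j%:R))).
  by apply: integrableZl_EFin => //; exact: integrable_norm_ratio_powR.
transitivity (\int[P]_w series (fun j => c j * norm_ratio w `^ (b + j%:R)) k.+1).
  rewrite (@Rintegral_series _ _ _ P setT measurableT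
    (fun j w => c j * norm_ratio w `^ (b + j%:R)))//.
  rewrite /delta /series/= big_mkord; apply: eq_bigr => j _.
  by rewrite mu_momentE RintegralZl//; exact: integrable_norm_ratio_powR.
apply: ae_eq_Rintegral.
- have := integrable_series measurableT k.+1 intc.
  by move=> /measurable_int/measurable_EFinP.
- exact: measurable_mixand.
apply: filterS norm_ratio_bounds => w /andP[u0 _].
by rewrite mixand_expand// /series/= big_mkord.
Qed.

Lemma mixture_cvg lambda r : 0 < lambda -> 0 < r ->
  series (fun k => delta X alpha k lambda * gbinom (b + k%:R - 1) k *
    gamma_cdf (b + k%:R) (lambda * r)) @ \oo --> H_radial X r.
Proof.
move=> l0 r0; rewrite radial_mixture//.
pose c k := gbinom (b + k%:R - 1) k * gamma_cdf (b + k%:R) (lambda * r).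
have c0 k : 0 <= c k.
  by rewrite mulr_ge0 ?gbinom_ge0// gamma_cdf_ge0// ltr_wpDr.
have NL : 0 <= 1 + N / lambda by rewrite addr_ge0// divr_ge0 ?sqrtr_ge0// ltW.
have [K hK] := gamma_cdf_series_bounded (lambda * r) b0 NL.
have intc k : P.-integrable setT (EFin \o (fun w => mixand lambda k w * c k)).
  rewrite (_ : (fun w => _) = fun w => c k * mixand lambda k w).
    by apply: integrableZl_EFin => //; exact: integrable_mixand.
  by apply/funext => w; rewrite mulrC.
rewrite (_ : (fun k => _) = fun k => \int[P]_w (mixand lambda k w * c k)); last first.
  by apply/funext => k; rewrite deltaE// -mulrA RintegralZr//; exact: integrable_mixand.
apply: (series_Rintegral_cvg measurableT (f_ := fun k w => mixand lambda k w * c k)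
  (f := fun w => gamma_cdf b (r * norm_ratio w)) (g := fun=> (N / lambda) `^ b * K)) => //.
- apply: (measurableT_comp (measurable_gamma_cdf b0)).
  by apply: measurable_funM; [exact: measurable_cst|exact: measurable_norm_ratio].
- apply: filterS norm_ratio_bounds => w /andP[u0 _] _.
  have v0 : 0 < norm_ratio w / lambda by rewrite divr_gt0.
  have := @gamma_cdf_mixture _ _ _ (lambda * r) b0 v0.
  rewrite (_ : norm_ratio w / lambda * (lambda * r) = r * norm_ratio w)//.
  by field; rewrite gt_eqF.
- apply: (@ae_bounded_integrable _ _ _ _ _ `|(N / lambda) `^ b * K|).
    exact: measurable_cst.
  by apply: aeW.
- apply: filterS norm_ratio_bounds => w uw _ m.
  apply: le_trans (ler_norm_sum _ _ _) _.
  apply: (@le_trans _ _ ((N / lambda) `^ b *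
      series (fun k => (1 + N / lambda) ^+ k * c k) m)).
    rewrite /series/= big_distrr/=; apply: ler_sum => k _.
    have [/andP[h1 h2] h3] := mixand_bounds l0 uw.
    rewrite /mixand normrM [X in X * _]normrM normrX (ger0_norm h1).
    rewrite (ger0_norm (c0 k)) [leRHS]mulrA.
    apply: ler_wpM2r => //; apply: ler_pM => //.
    by rewrite lerXn2r ?nnegrE// (le_trans _ h3).
  by apply: ler_wpM2l; [exact: powR_ge0|exact: hK].
Qed.

Lemma mixture_weights_cvg :
  series (fun k => gbinom (b + k%:R - 1) k * delta X alpha k N) @ \oo --> (1 : R).
Proof.
pose c k := gbinom (b + k%:R - 1) k.
have c0 k : 0 <= c k by exact: gbinom_ge0.
rewrite (_ : (fun k => _) = fun k => \int[P]_w (c k * mixand N k w)); last first.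
  by apply/funext => k; rewrite deltaE// RintegralZl//; exact: integrable_mixand.
have I1 : \int[P]_w (1 : R) = 1.
  rewrite Rintegral_cst// mul1r.
  have : fine (P setT) = 1 by rewrite probability_setT.
  exact.
have frac w : 0 < norm_ratio w <= N -> 0 < norm_ratio w / N <= 1.
  by move=> /andP[u0 uN]; rewrite divr_gt0//= ler_pdivrMr// mul1r.
have cvs w : 0 < norm_ratio w <= N ->
    series (fun k => c k * mixand N k w) @ \oo --> (1 : R).
  move=> uw; rewrite (_ : (fun k => _) = fun k => (norm_ratio w / N) `^ b *
      (1 - norm_ratio w / N) ^+ k * gbinom (b + k%:R - 1) k); last first.
    by apply/funext => k; rewrite mulrC.
  exact: negative_binomial_series (frac _ uw).
suff : series (fun k => \int[P]_w (c k * mixand N k w)) @ \oo --> \int[P]_w (1 : R).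
  by rewrite I1.
apply: (@series_Rintegral_cvg _ _ _ P setT measurableT
  (fun k w => c k * mixand N k w) (fun=> 1) (fun=> 1)).
- by move=> k; apply: integrableZl_EFin => //; exact: integrable_mixand.
- exact: measurable_cst.
- by apply: filterS norm_ratio_bounds => w uw _; exact: cvs.
- apply: (@ae_bounded_integrable _ _ _ _ _ 1); first exact: measurable_cst.
  by apply: aeW => w; rewrite normr1.
- apply: filterS norm_ratio_bounds => w uw _ m.
  have /andP[v0 v1] := frac w uw.
  have t0 k : 0 <= c k * mixand N k w.
    by rewrite mulr_ge0// mulr_ge0 ?powR_ge0// exprn_ge0// subr_ge0.
  rewrite ger0_norm; last by rewrite /series/=; apply: sumr_ge0.
  rewrite -[leRHS](cvg_lim _ (cvs w uw))//.
  apply: nondecreasing_cvgn_le; first by apply: nondecreasing_series.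
  by apply/cvg_ex; exists 1; exact: cvs.
Qed.

(** The density is bounded below on the interval; [m >= 1] allows the bound
    [x ^ (alpha - 1) >= x ^ (- 1)] for every [alpha > 0]. *)
Lemma gamma_rv_charges (i : 'I_n) (m : R) : 1 <= m ->
  (0 < P (X i @^-1` `]m, (m + 1)%R]))%E.
Proof.
move=> m1; have mp : 0 < m + 1 by rewrite addr_gt0// (lt_le_trans _ m1).
have G0 : 0 < (Gamma alpha)^-1 by rewrite invr_gt0 Gamma_gt0.
pose e : R := (Gamma alpha)^-1 * ((m + 1) `^ (- 1) * expR (- (m + 1))).
have e0 : 0 < e by rewrite mulr_gt0// mulr_gt0 ?expR_gt0// powR_gt0.
rewrite -[X in (0 < X)%E]/(distribution P (X i) `]m, m + 1]) hdens//.
apply: (@lt_le_trans _ _ (\int[mu]_(x in `]m, (m + 1)%R]) e%:E)%E).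
  rewrite integral_cst//= lebesgue_measure_itv/= lte_fin ltrDl ltr01.
  by rewrite -EFinD -EFinM lte_fin addrAC subrr add0r mulr1.
apply: ge0_le_integral => //.
- by move=> x _; rewrite lee_fin ltW.
- by apply: measurable_funTS; apply/measurable_EFinP; exact: measurable_gamma_density.
move=> x; rewrite /= in_itv/= => /andP[mx xm].
have x1 : 1 <= x by rewrite (le_trans m1)// ltW.
have x0 : 0 < x by rewrite (lt_le_trans _ x1).
rewrite lee_fin gamma_densityE// /e; apply: ler_wpM2l; first exact: ltW.
apply: ler_pM; [exact: powR_ge0|exact: expR_ge0| |by rewrite ler_expR lerN2].
apply: (@le_trans _ _ (x `^ (- 1))).
  by rewrite !powR_inv1 ?(ltW x0) ?(ltW mp)// lef_pV2 ?posrE.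
by apply: ler_powR => //; rewrite lerDr ltW.
Qed.

(** Almost surely the integrand vanishes only where [cos Phi = 1], that is, where all
    observations coincide; two of them lie in disjoint intervals with positive
    probability. *)
Lemma delta_pos k : 0 < delta X alpha k N.
Proof.
rewrite deltaE//.
pose i0 : 'I_n := Ordinal n0; pose i1 : 'I_n := Ordinal hn.
pose A0 := X i0 @^-1` `]1, 1 + 1]; pose A1 := X i1 @^-1` `]2, 2 + 1].
have mA0 : measurable A0 by exact: measurable_RV_preimage.
have mA1 : measurable A1 by exact: measurable_RV_preimage.
apply: (@Rintegral_gt0 _ _ _ P (mixand N k) (A0 `&` A1)).
- exact: integrable_mixand.
- apply: filterS norm_ratio_bounds => w /andP[u0 uN].
  rewrite mulr_ge0 ?powR_ge0// exprn_ge0// subr_ge0 ler_pdivrMr// mul1r//.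
- exact: measurableI.
- rewrite (@cylinders_indep _ _ _ _ _ _ hindep [:: i0] i1)//.
    by rewrite mule_gt0// gamma_rv_charges// ler1n.
  apply: sub_sigma_algebra; exists (fun=> `]1, 1 + 1]%classic); split => //.
  apply/seteqP; split => w /=; first by move=> h j; rewrite /= inE => /eqP ->.
  by move=> /(_ i0); rewrite /= inE eqxx => /(_ isT).
apply: filterS2 norm_ratio_bounds sample_sqsum_pos => w /andP[u0 uN] Qw [].
rewrite /A0 /A1 /= !in_itv/= => /andP[_ x0] /andP[x1 _].
have v0 : 0 < norm_ratio w / N by rewrite divr_gt0.
apply: mulf_neq0; first by rewrite gt_eqF// powR_gt0.
apply: expf_neq0; rewrite subr_eq0.
apply: contraTneq x0 => v1; rewrite -ltNge.
have E : X i0 w = X i1 w.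
  apply: (@sqr_sum_eq _ _ (fun i => X i w)).
  have : norm_ratio w = N by apply: (divIf (lt0r_neq0 N0)); rewrite -v1 divff// gt_eqF.
  rewrite /norm_ratio powRN powR12_sqrt ?(ltW Qw)//.
  move=> /(congr1 (fun x => x * Num.sqrt (Q w))).
  rewrite divfK ?gt_eqF ?sqrtr_gt0// => SE.
  rewrite -[LHS]/(S w ^+ 2) SE exprMn (sqr_sqrtr (ltW nR0)) (sqr_sqrtr (ltW Qw)).
  by [].
by rewrite E.
Qed.

End gamma_sample.

Theorem mainTheorem4 (R : realType) (d : measure_display)
  (T : measurableType d) (P : probability T R)
  (n : nat) (alpha : R) (X : 'I_n -> {RV P >-> R})
  (hn : (2 <= n)%N) (halpha : 0 < alpha)
  (hindep : mutually_independent X)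
  (hdens : forall i, has_density (X i) (gamma_density alpha)) :
  (forall lambda r : R, 0 < lambda -> 0 < r ->
     series (fun k : nat =>
       delta X alpha k lambda * gbinom (alpha * n%:R + k%:R - 1) k
         * gamma_cdf (alpha * n%:R + k%:R) (lambda * r)) @ \oo
     --> H_radial X r) /\
  (forall k : nat,
     ((delta X alpha k (Num.sqrt n%:R)%R)%:E =
      'E_P[fun w => (cos (Phi X w) `^ (alpha * n%:R)
                       * (1 - cos (Phi X w)) ^+ k)%R])%E /\
     0 < delta X alpha k (Num.sqrt n%:R)) /\
  series (fun k : nat =>
    gbinom (alpha * n%:R + k%:R - 1) k
      * delta X alpha k (Num.sqrt n%:R)) @ \oo --> (1 : R).
Proof.
have N0 : 0 < Num.sqrt (n%:R : R) by rewrite sqrtr_gt0 ltr0n (ltn_trans _ hn).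
split; first by move=> lambda r; exact: mixture_cvg.
split; last exact: mixture_weights_cvg.
move=> k; split; last exact: delta_pos.
rewrite deltaE// /Rintegral fineK; last first.
  by apply: integrable_fin_num => //; exact: integrable_mixand.
rewrite expectation.unlock; apply: eq_integral => w _.
by rewrite cos_Phi.
Qed.
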